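(* Let $0<\alpha\le2$, $q>4(1+\alpha)+5$ and $T>0$. For every $R>0$ (independent of $N$) there exist $h_0=h_0(R,q,\alpha,\Omega)>0$ and $C_R>0$, with $C_R$ independent of $N$ and $h$, such that the following holds. Let $N\ge1$, $t_*\in[0,T]$, $Z\in\mathbb X_N$, $0<h\le T-t_*$, and put $Y_N(t)=e^{Lt}S_N(t;t_*,Z)$. If $$\sup_{t_*\le t\le t_*+h}\|Y_N(t)\|_q\le R$$ and $0<h\le h_0$, then $$\left\|S_N(t_*+h;t_*,Z)-\Psi_N(t_*,h,Z)\right\|\le C_R h^5 .$$ In particular, taking $t_*=t_n$, $h=\Delta t$ and $Z=V_N(t_n)$, the local truncation error $\tau_{n+1}:=S_N(t_{n+1};t_n,V_N(t_n))-\Psi_N(t_n,\Delta t,V_N(t_n))$ satisfies $$\|\tau_{n+1}\|\le C_R\Delta t^5 .$$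
   Context: $\Omega=[-\pi,\pi]^2$ with periodic boundary conditions (the two-dimensional torus). All functions are real-valued. $\|\cdot\|$ is the $L^2_{\mathrm{per}}(\Omega)$ norm, $\hat f(\mathbf k)=(2\pi)^{-2}\int_\Omega f e^{-i\mathbf k\cdot\mathbf x}\,d\mathbf x$, and $\|u\|_q^2=\sum_{\mathbf k\in\mathbb Z^2}(1+|\mathbf k|^2)^q|\hat u(\mathbf k)|^2$. $\mathbb X_N$ is the space of (real-valued) trigonometric polynomials in $\mathrm{span}\{e^{i\mathbf k\cdot\mathbf x}:\max\{|k_1|,|k_2|\}\le N\}$, and $\Pi_N$ is the $L^2$-orthogonal projection onto it. Elements of $\mathbb X_N$ are identified with their vectors of Fourier coefficients (norms of a vector are the norms of the corresponding polynomial). $L$ is the Fourier multiplier on $\mathbb X_N$ with symbol $L_{\mathbf m}=im_1|\mathbf m|^\alpha$, and $\mathcal N(Y)=-\frac12\Pi_N\partial_{x_1}(Y^2)$, so that the Fourier--Galerkin semi-discretization of $\partial_t u-\partial_{x_1}(-\Delta)^{\alpha/2}u+u\,\partial_{x_1}u=0$, $u(0)=u_0$, reads $\frac{dU}{dt}=LU+\mathcal N(U)$, $U(0)=\Pi_N u_0$. With $V=e^{-Lt}U$ this becomes the transformed system $\frac{dV}{dt}=\mathcal F(t,V)$, $\mathcal F(t,V)=e^{-Lt}\mathcal N(e^{Lt}V)$. $S_N(t;t_*,Z)$ denotes the exact solution at time $t$ of the transformed system with value $Z$ at time $t_*$. $\Psi_N(t_*,h,Z)$ denotes one step of length $h$ of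 the classical RK4 method: $$\Psi_N(t_*,h,Z)=Z+\tfrac16\left(K_1+2K_2+2K_3+K_4\right),$$ $K_1=h\mathcal F(t_*,Z)$, $K_2=h\mathcal F(t_*+\frac h2,Z+\frac12K_1)$, $K_3=h\mathcal F(t_*+\frac h2,Z+\frac12K_2)$, $K_4=h\mathcal F(t_*+h,Z+K_3)$. For $M\in\mathbb N$: $\Delta t=T/M$, $t_n=n\Delta t$. $U_N(t)$ is the exact semi-discrete solution $u_N(t)$ of the Galerkin system $\frac{dU}{dt}=LU+\mathcal N(U)$ with $u_N(0)=\Pi_Nu_0$, and $V_N(t)=e^{-Lt}U_N(t)$. In the ''in particular'' statement the hypotheses of the first part are assumed for this choice, i.e. $\sup_{t_n\le t\le t_{n+1}}\|u_N(t)\|_q\le R$ and $\Delta t\le h_0$. *)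

(* Defs.v *)
From HB Require Import structures.
From mathcomp Require Import all_boot all_order all_algebra.
From mathcomp Require Import all_classical all_reals all_analysis.
From mathcomp Require Import complex.

Set Implicit Arguments.
Unset Strict Implicit.
Unset Printing Implicit Defensive.

Import Order.TTheory GRing.Theory Num.Theory.
Import numFieldNormedType.Exports.

Local Open Scope classical_set_scope.
Local Open Scope ring_scope.

Section Torus.
Context {R : realType}.
Local Notation C := (complex R).
Local Notation "x %:C" := (@real_complex_def _ (Phant R) x).
Local Notation mu2 := (@lebesgue_measure R \x @lebesgue_measure R)%E.
Local Notation "''i'" := (@Complex R 0 1).

(* Periodic functions enter only through their values on this square, on which
   all integrals below are taken. *)
Definition Omega : set (R * R) := `[- pi, pi]%classic `*` `[- pi, pi]%classic.

Definition cexp (z : C) : C :=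
  (expR (complex.Re z))%:C * Complex (cos (complex.Im z)) (sin (complex.Im z)).

Definition dotk (k : int * int) (x : R * R) : R :=
  k.1%:~R * x.1 + k.2%:~R * x.2.

Definition sqk (k : int * int) : R := k.1%:~R ^+ 2 + k.2%:~R ^+ 2.

Definition Cintegral (D : set (R * R)) (f : R * R -> C) : C :=
  Complex (\int[mu2]_(x in D) complex.Re (f x))
          (\int[mu2]_(x in D) complex.Im (f x)).

Definition fourier (f : R * R -> R) (k : int * int) : C :=
  ((2 * pi) ^- 2)%:C *
    Cintegral Omega (fun x => (f x)%:C * cexp (- 'i * (dotk k x)%:C)).

Definition L2 (f : R * R -> R) : Prop :=
  measurable_fun Omega f /\
  mu2.-integrable Omega (fun x => (f x ^+ 2)%:E).

(* Only meaningful for f in L2: the real-valued integral is 0 otherwise. *)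
Definition L2norm (f : R * R -> R) : R :=
  Num.sqrt (\int[mu2]_(x in Omega) f x ^+ 2).

Definition Hnorm (q : R) (f : R * R -> R) : \bar R :=
  ((\esum_(k in [set: int * int])
      ((1 + sqk k) `^ q * Normc.normc (fourier f k) ^+ 2)%:E) `^ 2^-1)%E.

Definition freqs (N : nat) : seq int :=
  [seq i%:Z - N%:Z | i <- iota 0 (2 * N).+1].

Definition modes (N : nat) : seq (int * int) :=
  [seq (k1, k2) | k1 <- freqs N, k2 <- freqs N].

Lemma mem_freqs N (m : int) : (m \in freqs N) = (`|m| <= N%:Z).
Proof.
apply/mapP/idP => [[i + ->]|].
  rewrite mem_iota add0n ltnS ler_norml => iN.
  rewrite lerBrDr addNr lez_nat leq0n /= lerBlDr -PoszD lez_nat.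
  by rewrite addnn -mul2n.
rewrite ler_norml => /andP[m1 m2].
have m0 : 0 <= m + N%:Z by rewrite -lerBlDr sub0r.
exists (absz (m + N%:Z)); last by rewrite gez0_abs// addrK.
rewrite mem_iota add0n ltnS /= -lez_nat gez0_abs// mul2n -addnn PoszD.
by rewrite lerD2r.
Qed.

Lemma mem_modes N (k : int * int) :
  (k \in modes N) = (Num.max `|k.1| `|k.2| <= N%:Z).
Proof.
case: k => k1 k2; rewrite ge_max -!mem_freqs /=.
apply/allpairsP/andP => [[[a b] [/= aN bN [-> ->]]]//|[aN bN]].
by exists (k1, k2).
Qed.

Lemma uniq_modes N : uniq (modes N).
Proof.
have uf : uniq (freqs N).
  rewrite map_inj_uniq ?iota_uniq// => i j /addIr; by case.
by apply: allpairs_uniq => // -[? ?] [? ?] _ _ [-> ->].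
Qed.

(* A trigonometric polynomial is represented by its family of Fourier
   coefficients. *)
Definition coefs := int * int -> C.

Definition trigpoly (N : nat) (c : coefs) (x : R * R) : C :=
  \sum_(k <- modes N) c k * cexp ('i * (dotk k x)%:C).

Definition XN (N : nat) (c : coefs) : Prop :=
  (forall k, k \notin modes N -> c k = 0) /\
  (forall x, complex.Im (trigpoly N c x) = 0).

(* The real-valued function represented by c; for c in XN, trigpoly N c is
   real-valued, so that taking the real part only changes the codomain. *)
Definition poly_of (N : nat) (c : coefs) (x : R * R) : R :=
  complex.Re (trigpoly N c x).

Definition supHnorm (q : R) (N : nat) (a b : R) (Y : R -> coefs) : \bar R :=
  ereal_sup [set Hnorm q (poly_of N (Y t)) | t in `[a, b]].

(* L2-orthogonal projection onto XN: the residual is orthogonal to XN. *)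
Definition is_proj (N : nat) (f : R * R -> R) (c : coefs) : Prop :=
  XN N c /\
  forall d, XN N d ->
    \int[mu2]_(x in Omega) ((f x - poly_of N c x) * poly_of N d x) = 0.

Definition PiN (N : nat) (f : R * R -> R) : coefs :=
  xget (fun=> 0) [set c | is_proj N f c].

Definition dx1 (f : R * R -> R) (x : R * R) : R :=
  derive1 (fun s : R => f (s, x.2)) x.1.

Definition Lsym (alpha : R) (m : int * int) : C :=
  'i * (m.1%:~R * Num.sqrt (sqk m) `^ alpha)%:C.

Definition Lop (alpha : R) (c : coefs) : coefs := fun m => Lsym alpha m * c m.

Definition expL (alpha t : R) (c : coefs) : coefs :=
  fun m => cexp (Lsym alpha m * t%:C) * c m.

Definition Nonlin (N : nat) (c : coefs) : coefs :=
  (- 2^-1)%:C *: PiN N (dx1 (fun x => poly_of N c x ^+ 2)).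

Definition galerkin (alpha : R) (N : nat) (t : R) (c : coefs) : coefs :=
  Lop alpha c + Nonlin N c.

Definition transformed (alpha : R) (N : nat) (t : R) (c : coefs) : coefs :=
  expL alpha (- t) (Nonlin N (expL alpha t c)).

(* XN-valued solutions of Y' = G(t, Y) on [a, b]; continuity, including at the
   end points, and differentiability are stated coefficient by coefficient. *)
Definition is_solution (N : nat) (G : R -> coefs -> coefs) (a b : R)
    (Y : R -> coefs) : Prop :=
  (forall t, t \in `[a, b] -> XN N (Y t)) /\
  forall k,
    [/\ {within `[a, b], continuous (fun t => complex.Re (Y t k))},
        {within `[a, b], continuous (fun t => complex.Im (Y t k))} &
        forall t, t \in `]a, b[ ->
          is_derive t 1 (fun s => complex.Re (Y s k))
            (complex.Re (G t (Y t) k)) /\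
          is_derive t 1 (fun s => complex.Im (Y s k))
            (complex.Im (G t (Y t) k))].

(* S t is the value at time t in [ts, te] of the solution of the transformed
   system which equals Z at time ts. *)
Definition is_exact_flow (alpha : R) (N : nat) (ts te : R) (Z : coefs)
    (S : R -> coefs) : Prop :=
  is_solution N (transformed alpha N) ts te S /\ S ts = Z.

Definition RK4 (F : R -> coefs -> coefs) (ts h : R) (Z : coefs) : coefs :=
  let K1 := h%:C *: F ts Z in
  let K2 := h%:C *: F (ts + h / 2) (Z + (2^-1)%:C *: K1) in
  let K3 := h%:C *: F (ts + h / 2) (Z + (2^-1)%:C *: K2) in
  let K4 := h%:C *: F (ts + h) (Z + K3) in
  Z + (6^-1)%:C *: (K1 + K2 *+ 2 + K3 *+ 2 + K4).

Definition Psi (alpha : R) (N : nat) (ts h : R) (Z : coefs) : coefs :=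
  RK4 (transformed alpha N) ts h Z.

End Torus.

(* Main.v *)
Require Import Defs.
From mathcomp Require Import all_boot all_order all_algebra.
From mathcomp Require Import all_classical all_reals all_analysis.
From mathcomp Require Import complex.
From mathcomp Require Import measurable_realfun ring lra.
Import Order.TTheory GRing.Theory Num.Theory.
Import numFieldNormedType.Exports.
Local Open Scope classical_set_scope.
Local Open Scope ring_scope.

(** The difficulty is uniformity in [N]: in a fixed space of trigonometric
    polynomials everything is smooth, but derivatives of the vector field grow
    with [N]. All estimates are therefore made in a scale of weighted Wiener
    norms (sums of moduli of Fourier coefficients), in which one grade stands
    for [1 + alpha] derivatives. One grade pays for one application of [L], and
    also for one application of the nonlinearity [bil], because the Wiener norms
    are submultiplicative ([wnorm_bil]). Since [q > 4 (1 + alpha) + 5] and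
    [alpha <= 2], the Sobolev bound controls five grades ([wnorm5_le_Hnorm]).

    The Galerkin equation then gives five time derivatives of the solution, the
    [l]-th one in grade [5 - l], with bounds that depend on the radius only
    ([smooth_galerkin], [flow_chain]). Conjugation by the isometries [expL]
    transfers this to the transformed solution. A vector-valued mean value
    inequality ([cdiff_mvt]) yields Taylor expansions, and hence error bounds for
    Simpson's rule and for a few lower-order quadrature rules.

    The transformed field is quadratic in the unknown, so that the variation of
    each stage of the method about the exact solution is the sum of a linear and
    a quadratic term in the stage error. With [e2], [e3], [e4] the errors of the
    stages two to four, [e2] and [e3] are of second order in the step, [e2 + e3]
    and [e4] of third order, and [2 (e2 + e3) + e4] of fourth order, since up to
    higher-order terms each of these combinations is a quadrature error of the
    exact solution. The linear terms enter the final quadrature exactly through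
    the last combination, apart from the displacement of the base point from the
    middle to the end of the step, which gains one power of the step
    ([RK4_error]). Every loss of grades stays within the five available.

    What remains links this to the integral definitions. Orthogonality of the
    waves on the square identifies the projected nonlinearity with a convolution
    of Fourier coefficients ([Nonlin_bil]) and recovers coefficients from the
    Sobolev norm ([fourier_poly_of]). For the second assertion, the transformed
    Galerkin solution coincides with the flow by uniqueness ([flow_unique]). *)

Set Implicit Arguments.
Unset Strict Implicit.
Unset Printing Implicit Defensive.

(** * Complex-valued functions of a real variable *)

Section ComplexCalculus.
Context {R : realType}.
Local Notation C := (complex R).
Local Notation Re := (@complex.Re R).
Local Notation Im := (@complex.Im R).
Implicit Types (a b t : R) (u v : R -> C) (z : C).

Lemma Re_add z w : Re (z + w) = Re z + Re w.
Proof. by case: z; case: w. Qed.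

Lemma Im_add z w : Im (z + w) = Im z + Im w.
Proof. by case: z; case: w. Qed.

Lemma Re_mul z w : Re (z * w) = Re z * Re w - Im z * Im w.
Proof. by case: z; case: w. Qed.

Lemma Im_mul z w : Im (z * w) = Re z * Im w + Im z * Re w.
Proof. by case: z => a b; case: w. Qed.

Lemma complex_eq z w : Re z = Re w -> Im z = Im w -> z = w.
Proof. by case: z => ? ?; case: w => ? ? /= -> ->. Qed.

Lemma Re_sum (I : Type) (r : seq I) (P : pred I) (F : I -> C) :
  Re (\sum_(i <- r | P i) F i) = \sum_(i <- r | P i) Re (F i).
Proof. exact: (big_morph _ Re_add erefl). Qed.

Lemma Im_sum (I : Type) (r : seq I) (P : pred I) (F : I -> C) :
  Im (\sum_(i <- r | P i) F i) = \sum_(i <- r | P i) Im (F i).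
Proof. exact: (big_morph _ Im_add erefl). Qed.

(** No one-sided derivative is asked for at the end points, as for a solution of
    an evolution equation on a compact time interval. *)
Definition has_cderiv a b u v : Prop :=
  [/\ {within `[a, b], continuous (fun t => Re (u t))},
      {within `[a, b], continuous (fun t => Im (u t))} &
      forall t, t \in `]a, b[ ->
        is_derive t 1 (fun s => Re (u s)) (Re (v t)) /\
        is_derive t 1 (fun s => Im (u s)) (Im (v t))].

Lemma has_cderiv_cst a b z : has_cderiv a b (fun=> z) (fun=> 0).
Proof.
split=> [||t _]; try by apply: continuous_subspaceT => ?; exact: cvg_cst.
by split; exact: is_derive_cst.
Qed.

Lemma has_cderivD a b u v u1 v1 :
  has_cderiv a b u u1 -> has_cderiv a b v v1 ->
  has_cderiv a b (fun t => u t + v t) (fun t => u1 t + v1 t).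
Proof.
move=> [cu cu' du] [cv cv' dv]; split=> [||t tab].
- have -> : (fun t => Re (u t + v t)) = (fun t => Re (u t) + Re (v t)).
    by apply/funext => t; rewrite Re_add.
  by move=> x; apply: cvgD; [exact: cu|exact: cv].
- have -> : (fun t => Im (u t + v t)) = (fun t => Im (u t) + Im (v t)).
    by apply/funext => t; rewrite Im_add.
  by move=> x; apply: cvgD; [exact: cu'|exact: cv'].
- have [du1 du2] := du _ tab; have [dv1 dv2] := dv _ tab; split.
  + rewrite Re_add; under [X in is_derive _ _ X _]funext do rewrite Re_add.
    exact: is_deriveD.
  + rewrite Im_add; under [X in is_derive _ _ X _]funext do rewrite Im_add.
    exact: is_deriveD.
Qed.

Lemma has_cderivM a b u v u1 v1 :
  has_cderiv a b u u1 -> has_cderiv a b v v1 ->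
  has_cderiv a b (fun t => u t * v t) (fun t => u1 t * v t + u t * v1 t).
Proof.
move=> [cu cu' du] [cv cv' dv]; split=> [||t tab].
- have -> : (fun t => Re (u t * v t)) =
    (fun t => Re (u t) * Re (v t) - Im (u t) * Im (v t)).
    by apply/funext => t; rewrite Re_mul.
  by move=> x; apply: cvgB; apply: cvgM;
    [exact: cu|exact: cv|exact: cu'|exact: cv'].
- have -> : (fun t => Im (u t * v t)) =
    (fun t => Re (u t) * Im (v t) + Im (u t) * Re (v t)).
    by apply/funext => t; rewrite Im_mul.
  by move=> x; apply: cvgD; apply: cvgM;
    [exact: cu|exact: cv'|exact: cu'|exact: cv].
- have [du1 du2] := du _ tab; have [dv1 dv2] := dv _ tab; split.
  + under [X in is_derive _ _ X _]funext do rewrite Re_mul.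
    have d := is_deriveB (is_deriveM du1 dv1) (is_deriveM du2 dv2).
    refine (is_derive_eq d _).
    by rewrite Re_add !Re_mul /GRing.scale/=; ring.
  + under [X in is_derive _ _ X _]funext do rewrite Im_mul.
    have d := is_deriveD (is_deriveM du1 dv2) (is_deriveM du2 dv1).
    refine (is_derive_eq d _).
    by rewrite Im_add !Im_mul /GRing.scale/=; ring.
Qed.

Lemma has_cderivMl a b z u u1 : has_cderiv a b u u1 ->
  has_cderiv a b (fun t => z * u t) (fun t => z * u1 t).
Proof.
move=> /(has_cderivM (has_cderiv_cst a b z)).
by under [X in has_cderiv _ _ _ X -> _]funext do rewrite mul0r add0r.
Qed.

Lemma has_cderiv_sum (I : Type) (r : seq I) (P : pred I) a b
    (F F1 : I -> R -> C) :
  (forall i, P i -> has_cderiv a b (F i) (F1 i)) ->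
  has_cderiv a b (fun t => \sum_(i <- r | P i) F i t)
                 (fun t => \sum_(i <- r | P i) F1 i t).
Proof.
move=> dF; elim: r => [|i r IH].
  under [X in has_cderiv _ _ X _]funext do rewrite big_nil.
  under [X in has_cderiv _ _ _ X]funext do rewrite big_nil.
  exact: has_cderiv_cst.
under [X in has_cderiv _ _ X _]funext do rewrite big_cons.
under [X in has_cderiv _ _ _ X]funext do rewrite big_cons.
by case Pi: (P i) => //; apply: has_cderivD => //; exact: dF.
Qed.

Lemma has_cderiv_real a b (f f1 : R -> R) :
  (forall t, is_derive t 1 f (f1 t)) ->
  has_cderiv a b (fun t => Complex (f t) 0) (fun t => Complex (f1 t) 0).
Proof.
move=> df; split=> [||t _] /=.
- apply: derivable_within_continuous => t _; exact: ex_derive.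
- by apply: continuous_subspaceT => ?; exact: cvg_cst.
- by split=> //; exact: is_derive_cst.
Qed.

Lemma has_cderiv_sub a b a' b' u u1 : a <= a' -> b' <= b ->
  has_cderiv a b u u1 -> has_cderiv a' b' u u1.
Proof.
move=> aa bb [cu cu' du].
have sub : `[a', b'] `<=` `[a, b].
  move=> t /=; rewrite !in_itv/= => /andP[h1 h2].
  by rewrite (le_trans aa h1) (le_trans h2 bb).
split=> [||t]; try exact: continuous_subspaceW sub _.
rewrite in_itv/= => /andP[h1 h2]; apply: du.
by rewrite in_itv/= (le_lt_trans aa h1) (lt_le_trans h2 bb).
Qed.

Lemma eq_has_cderiv a b u u1 v v1 : u =1 v ->
  (forall t, t \in `]a, b[ -> u1 t = v1 t) ->
  has_cderiv a b u u1 -> has_cderiv a b v v1.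
Proof.
move=> /funext <- eq1 [cu cu' du]; split=> // t tab.
by rewrite -eq1//; exact: du.
Qed.

Lemma cexp_imag (x : R) : cexp (Complex 0 x) = Complex (cos x) (sin x).
Proof.
by rewrite /cexp /= expR0; apply: complex_eq; rewrite ?Re_mul ?Im_mul/=; ring.
Qed.

Lemma has_cderiv_cexp a b (w : R) :
  has_cderiv a b (fun t => cexp (Complex 0 (w * t)))
                 (fun t => Complex 0 w * cexp (Complex 0 (w * t))).
Proof.
have dw t : is_derive t 1 (fun s => w * s : R) w.
  by apply: is_derive_eq; rewrite /GRing.scale/= mulr1.
have dc t : is_derive t 1 (fun s => cos (w * s)) (- (w * sin (w * t))).
  have d := is_derive1_comp (is_derive_cos (w * t)) (dw t).
  refine (is_derive_eq d _).
  by rewrite /GRing.scale/= mulNr mulrC.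
have ds t : is_derive t 1 (fun s => sin (w * s)) (w * cos (w * t)).
  have d := is_derive1_comp (is_derive_sin (w * t)) (dw t).
  refine (is_derive_eq d _).
  by rewrite /GRing.scale/= mulrC.
split=> [||t _].
- under [X in {within _, continuous X}]funext do rewrite cexp_imag/=.
  by apply: derivable_within_continuous => t _; exact: ex_derive.
- under [X in {within _, continuous X}]funext do rewrite cexp_imag/=.
  by apply: derivable_within_continuous => t _; exact: ex_derive.
- rewrite Re_mul Im_mul; split.
  + under [X in is_derive _ _ X _]funext do rewrite cexp_imag/=.
    by rewrite !cexp_imag/=; refine (is_derive_eq (dc t) _); ring.
  + under [X in is_derive _ _ X _]funext do rewrite cexp_imag/=.
    by rewrite !cexp_imag/=; refine (is_derive_eq (ds t) _); ring.
Qed.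

(** ** Modulus *)

Local Notation nc := Normc.normc.

Lemma normc_ge0 z : 0 <= nc z.
Proof. by case: z => x y; exact: sqrtr_ge0. Qed.

Lemma sqr_normcE z : nc z ^+ 2 = Re z ^+ 2 + Im z ^+ 2.
Proof. by case: z => x y /=; rewrite sqr_sqrtr// addr_ge0// sqr_ge0. Qed.

Lemma normcN z : nc (- z) = nc z.
Proof. by case: z => x y /=; rewrite !sqrrN. Qed.

Lemma normc_real (x : R) : nc (Complex x 0) = `|x|.
Proof. by rewrite /= expr0n addr0 sqrtr_sqr. Qed.

Lemma normc_imag (x : R) : nc (Complex 0 x) = `|x|.
Proof. by rewrite /= expr0n add0r sqrtr_sqr. Qed.

Lemma normc_cexp_imag (x : R) : nc (cexp (Complex 0 x)) = 1.
Proof. by rewrite cexp_imag /= cos2Dsin2 sqrtr1. Qed.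

Lemma le_normc_sum (I : Type) (r : seq I) (P : pred I) (F : I -> C) :
  nc (\sum_(i <- r | P i) F i) <= \sum_(i <- r | P i) nc (F i).
Proof.
elim/big_rec2: _ => [|i y x _ xy]; first by rewrite Normc.normc0.
by apply: le_trans (le_normcD _ _) _; rewrite lerD2l.
Qed.

Lemma le_Re_normc z : `|Re z| <= nc z.
Proof.
rewrite -[leLHS]sqrtr_sqr; case: z => x y /=.
by apply: ler_wsqrtr; rewrite lerDl sqr_ge0.
Qed.

(** Turns a sum of moduli into the real part of a linear functional. *)
Lemma exists_phase z : exists2 e : C, nc e <= 1 & e * z = Complex (nc z) 0.
Proof.
have [z0|z0] := eqVneq (nc z) 0.
  by exists 0; rewrite ?Normc.normc0 // z0 mul0r.
exists (Complex (Re z / nc z) (- Im z / nc z)).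
  rewrite /= !expr_div_n sqrrN -mulrDl -sqr_normcE divff ?sqrtr1//.
  by rewrite expf_eq0.
apply: complex_eq; rewrite ?Re_mul ?Im_mul/=; last by field.
transitivity (nc z ^+ 2 / nc z); last by field.
by rewrite sqr_normcE; field.
Qed.

End ComplexCalculus.

(** * Fourier orthogonality on the square *)

Section Orthogonality.
Context {R : realType}.
Local Notation C := (complex R).
Local Notation Re := (@complex.Re R).
Local Notation Im := (@complex.Im R).
Local Notation leb := (@lebesgue_measure R).
Local Notation mu2 := (leb \x leb)%E.
Local Notation Omega := (@Omega R).
Local Notation side := (`[- pi, pi]%classic : set R).

Let ltNpipi : - pi < pi :> R.
Proof. by have := @pi_gt0 R; lra. Qed.

Lemma measurable_Omega : measurable Omega.
Proof. exact: measurableX. Qed.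
Hint Resolve measurable_Omega : core.

Lemma measure_Omega : mu2 Omega = ((2 * pi) ^+ 2)%:E.
Proof.
have l : leb side = (2 * pi)%:E.
  rewrite lebesgue_measure_itv/= lte_fin ltNpipi -EFinB.
  by congr EFin; ring.
rewrite product_measure1E//; transitivity (leb side * leb side)%E => //.
by rewrite l -EFinM.
Qed.

Lemma integral_cos_side (m : int) (c : R) : m != 0 ->
  (\int[leb]_(x in side) (cos (m%:~R * x + c))%:E = 0)%E.
Proof.
move=> m0; have mR : m%:~R != 0 :> R by rewrite intr_eq0.
pose F (x : R) := m%:~R ^-1 * sin (m%:~R * x + c).
have dF (x : R) : is_derive x 1 F (cos (m%:~R * x + c)).
  have d1 : is_derive x 1 (fun s : R => m%:~R * s + c) m%:~R.
    by apply: is_derive_eq; rewrite /GRing.scale/= mulr1 addr0.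
  have d := is_deriveZ m%:~R^-1 (is_derive1_comp (is_derive_sin _) d1).
  by refine (is_derive_eq d _); rewrite /GRing.scale/=; field.
have cF : continuous F.
  by move=> x; apply/differentiable_continuous/derivable1_diffP/ex_derive.
rewrite (@continuous_FTC2 _ _ F)//.
- have mpi : sin (m%:~R * pi) = 0 :> R.
    have npi n : sin (n%:R * pi) = 0 :> R.
      elim: n => [|n IH]; first by rewrite mul0r sin0.
      by rewrite -natr1 mulrDl mul1r sinD IH sinpi mul0r mulr0 addr0.
    by case: (m) => n; rewrite ?NegzE ?mulrNz ?mulNr ?sinN -pmulrn npi ?oppr0.
  rewrite -EFinB; congr EFin; rewrite /F -mulrBr; apply/eqP.
  by rewrite mulf_eq0 mulrN !sinD sinN cosN mpi; apply/orP; right; apply/eqP; ring.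
- apply: derivable_within_continuous => x _.
  have d1 : is_derive x 1 (fun s : R => m%:~R * s + c) m%:~R.
    by apply: is_derive_eq; rewrite /GRing.scale/= mulr1 addr0.
  have d := is_derive1_comp (is_derive_cos _) d1.
  exact: ex_derive.
- split=> [x _||]; first exact: ex_derive.
  + by apply: cvg_at_right_filter; exact: cF.
  + by apply: cvg_at_left_filter; exact: cF.
- by move=> x _; rewrite derive1E; exact: derive_val.
Qed.

(** By Fubini's theorem it suffices that the integrals over one family of
    parallel slices vanish. *)
Lemma Rintegral_Omega_slice2 (f : R * R -> R) :
  mu2.-integrable Omega (EFin \o f) ->
  (forall x, \int[leb]_(y in side) (f (x, y))%:E = 0)%E ->
  \int[mu2]_(x in Omega) f x = 0.
Proof.
have intW := integrable_mkcond (mu := mu2) (EFin \o f) measurable_Omega.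
move=> /intW fi' f0; rewrite /Rintegral integral_mkcond.
rewrite -integral12_prod_meas1; last exact: fi'.
rewrite (eq_integral (cst 0%E)) ?integral0// => x _.
rewrite /fubini_F; have [xs|xs] := boolP (x \in side).
  rewrite -[RHS](f0 x) [RHS]integral_mkcond; apply: eq_integral => y _.
  rewrite !patchE; suff -> : ((x, y) \in Omega) = (y \in side) by [].
  by apply/idP/idP => /set_mem h; apply/mem_set;
    [case: h|split=> //; exact/set_mem].
rewrite (eq_integral (cst 0%E)) ?integral0// => y _.
rewrite patchE; case: ifPn => // /set_mem[/= xs' _].
by case/negP: xs; exact/mem_set.
Qed.

Lemma Rintegral_Omega_slice1 (f : R * R -> R) :
  mu2.-integrable Omega (EFin \o f) ->
  (forall y, \int[leb]_(x in side) (f (x, y))%:E = 0)%E ->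
  \int[mu2]_(x in Omega) f x = 0.
Proof.
have intW := integrable_mkcond (mu := mu2) (EFin \o f) measurable_Omega.
move=> /intW fi' f0; rewrite /Rintegral integral_mkcond.
rewrite -integral21_prod_meas1; last exact: fi'.
rewrite (eq_integral (cst 0%E)) ?integral0// => y _.
rewrite /fubini_G; have [ys|ys] := boolP (y \in side).
  rewrite -[RHS](f0 y) [RHS]integral_mkcond; apply: eq_integral => x _.
  rewrite !patchE; suff -> : ((x, y) \in Omega) = (x \in side) by [].
  by apply/idP/idP => /set_mem h; apply/mem_set;
    [case: h|split=> //; exact/set_mem].
rewrite (eq_integral (cst 0%E)) ?integral0// => x _.
rewrite patchE; case: ifPn => // /set_mem[/= _ ys'].
by case/negP: ys; exact/mem_set.
Qed.

Lemma bounded_integrable_Omega (f : R * R -> R) (M : R) :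
  measurable_fun Omega f -> (forall x, `|f x| <= M) ->
  mu2.-integrable Omega (EFin \o f).
Proof.
have fin : (mu2 Omega < +oo)%E by rewrite measure_Omega ltry.
move=> mf bf; apply: measurable_bounded_integrable => //.
exists M; split=> [|N MN x _]; first exact: num_real.
exact: le_trans (bf x) (ltW MN).
Qed.

Lemma measurable_cos_dotk (k : int * int) (c : R) (D : set (R * R)) :
  measurable D -> measurable_fun D (fun x => cos (dotk k x + c)).
Proof.
move=> mD.
apply: (@measurableT_comp _ _ _ _ _ _ (@cos R)).
  exact: continuous_measurable_fun (@continuous_cos R).
apply: measurable_funD => //; apply: measurable_funD; apply: measurable_funM => //.
- exact: measurableT_comp measurable_fst _.
- exact: measurableT_comp measurable_snd _.
Qed.

Lemma integrable_cos_dotk (k : int * int) (c : R) :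
  mu2.-integrable Omega (EFin \o (fun x => cos (dotk k x + c))).
Proof.
apply: (@bounded_integrable_Omega _ 1); first exact: measurable_cos_dotk.
by move=> x; rewrite ler_norml cos_geN1 cos_le1.
Qed.

Lemma Rintegral_cos_dotk (k : int * int) (c : R) : k != 0 ->
  \int[mu2]_(x in Omega) cos (dotk k x + c) = 0.
Proof.
case: k => k1 k2; have [->|k10] := eqVneq k1 0; last first.
  move=> _; apply: Rintegral_Omega_slice1; first exact: integrable_cos_dotk.
  move=> y; rewrite -[RHS](@integral_cos_side k1 (k2%:~R * y + c) k10).
  by apply: eq_integral => x _; rewrite /dotk/= addrA.
have [->|k20 _] := eqVneq k2 0; first by rewrite eqxx.
apply: Rintegral_Omega_slice2; first exact: integrable_cos_dotk.
move=> x; rewrite -[RHS](@integral_cos_side k2 c k20).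
by apply: eq_integral => y _; rewrite /dotk/= mul0r add0r.
Qed.

(** Integrability is part of the predicate, which makes it stable under linear
    combinations. *)
Definition has_Rintegral (f : R * R -> R) (v : R) : Prop :=
  mu2.-integrable Omega (EFin \o f) /\ \int[mu2]_(x in Omega) f x = v.

Definition has_Cintegral (f : R * R -> C) (v : C) : Prop :=
  has_Rintegral (fun x => Re (f x)) (Re v) /\ has_Rintegral (fun x => Im (f x)) (Im v).

Lemma has_RintegralD f g v w : has_Rintegral f v -> has_Rintegral g w ->
  has_Rintegral (fun x => f x + g x) (v + w).
Proof.
move=> [fi <-] [gi <-]; split; last exact: RintegralD.
by have := integrableD (mu := mu2) measurable_Omega fi gi.
Qed.

Lemma has_RintegralZ f v (r : R) : has_Rintegral f v ->
  has_Rintegral (fun x => r * f x) (r * v).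
Proof.
move=> [fi <-]; split; last exact: RintegralZl.
have := integrableZl (mu := mu2) measurable_Omega r fi.
by under [X in integrable _ _ X -> _]funext do rewrite /= -EFinM.
Qed.

Lemma has_CintegralD f g v w : has_Cintegral f v -> has_Cintegral g w ->
  has_Cintegral (fun x => f x + g x) (v + w).
Proof.
move=> [f1 f2] [g1 g2]; split.
- under [X in has_Rintegral X _]funext do rewrite Re_add.
  by rewrite Re_add; exact: has_RintegralD.
- under [X in has_Rintegral X _]funext do rewrite Im_add.
  by rewrite Im_add; exact: has_RintegralD.
Qed.

Lemma has_CintegralZ f v (z : C) : has_Cintegral f v ->
  has_Cintegral (fun x => z * f x) (z * v).
Proof.
move=> [f1 f2]; split.
- under [X in has_Rintegral X _]funext do rewrite Re_mul -mulNr.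
  by rewrite Re_mul -mulNr; apply: has_RintegralD; exact: has_RintegralZ.
- under [X in has_Rintegral X _]funext do rewrite Im_mul.
  by rewrite Im_mul; apply: has_RintegralD; exact: has_RintegralZ.
Qed.

Lemma has_Cintegral0 : has_Cintegral (fun=> 0) 0.
Proof.
split; split; rewrite /comp/=; by [exact: integrable0|rewrite Rintegral_cst ?mul0r].
Qed.

Lemma has_Cintegral_sum (I : Type) (r : seq I) (P : pred I) (f : I -> R * R -> C)
    (v : I -> C) : (forall i, P i -> has_Cintegral (f i) (v i)) ->
  has_Cintegral (fun x => \sum_(i <- r | P i) f i x) (\sum_(i <- r | P i) v i).
Proof.
move=> fv; elim: r => [|i r IH].
  by under [X in has_Cintegral X _]funext do rewrite big_nil; rewrite big_nil; exact: has_Cintegral0.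
under [X in has_Cintegral X _]funext do rewrite big_cons.
by rewrite big_cons; case Pi: (P i) => //; apply: has_CintegralD => //; exact: fv.
Qed.

Lemma has_Cintegral_uniq f v w : has_Cintegral f v -> has_Cintegral f w -> v = w.
Proof.
by move=> [[_ f1] [_ f2]] [[_ g1] [_ g2]]; apply: complex_eq;
  rewrite -?f1 -?f2.
Qed.

Definition wave (k : int * int) (x : R * R) : C := cexp (Complex 0 (dotk k x)).

Lemma waveE k x : wave k x = Complex (cos (dotk k x)) (sin (dotk k x)).
Proof. exact: cexp_imag. Qed.

Lemma dotkD (k l : int * int) (x : R * R) : dotk (k + l) x = dotk k x + dotk l x.
Proof. by rewrite /dotk/= !rmorphD/=; ring. Qed.

Lemma dotkN (k : int * int) (x : R * R) : dotk (- k) x = - dotk k x.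
Proof. by rewrite /dotk/= !rmorphN/=; ring. Qed.

Lemma waveD k l x : wave (k + l) x = wave k x * wave l x.
Proof.
rewrite !waveE dotkD cosD sinD.
by apply: complex_eq; rewrite ?Re_mul ?Im_mul/=; ring.
Qed.

Definition area : C := Complex ((2 * pi) ^+ 2) 0.

Lemma area_neq0 : area != 0.
Proof.
apply/eqP => /(congr1 Re)/= /eqP; rewrite expf_eq0/= mulf_eq0.
by rewrite pnatr_eq0/= gt_eqF ?pi_gt0.
Qed.

Lemma has_Cintegral_wave k : has_Cintegral (wave k) (area * (k == 0)%:R).
Proof.
have [->|k0] := eqVneq k 0.
  have w1 x : wave 0 x = 1.
    by rewrite waveE /dotk/= !mul0r addr0 cos0 sin0.
  rewrite mulr1; split; split; rewrite /comp.
  - under [X in integrable _ _ X]funext do rewrite w1/=.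
    by apply: (@bounded_integrable_Omega (fun=> 1) 1) => // x; rewrite normr1.
  - under eq_Rintegral do rewrite w1/=.
    rewrite Rintegral_cst// mul1r; transitivity (fine (mu2 Omega)) => //.
    by rewrite measure_Omega.
  - under [X in integrable _ _ X]funext do rewrite w1/=.
    exact: integrable0.
  - under eq_Rintegral do rewrite w1/=.
    by rewrite Rintegral_cst// mul0r.
rewrite mulr0; split; split; rewrite /comp.
- under [X in integrable _ _ X]funext do rewrite waveE/= -[dotk k _]addr0.
  exact: integrable_cos_dotk.
- under eq_Rintegral do rewrite waveE/= -[dotk k _]addr0.
  exact: Rintegral_cos_dotk.
- under [X in integrable _ _ X]funext do rewrite waveE/= -cosBpihalf.
  exact: integrable_cos_dotk.
- under eq_Rintegral do rewrite waveE/= -cosBpihalf.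
  exact: Rintegral_cos_dotk.
Qed.

End Orthogonality.

(** * Fourier coefficients of trigonometric polynomials *)

Section FourierCoefficients.
Context {R : realType}.
Local Notation C := (complex R).
Local Notation Re := (@complex.Re R).
Local Notation Im := (@complex.Im R).
Local Notation Omega := (@Omega R).
Local Notation coefs := (@coefs R).
Local Notation mu2 := (@lebesgue_measure R \x @lebesgue_measure R)%E.
Implicit Types (N : nat) (c d : coefs) (k m p : int * int).

Lemma imag_real (x : R) :
  Complex 0 1 * (@real_complex_def _ (Phant R) x) = Complex 0 x.
Proof. by apply: complex_eq; rewrite ?Re_mul ?Im_mul/=; ring. Qed.

Lemma trigpolyE N c x : trigpoly N c x = \sum_(k <- modes N) c k * wave k x.
Proof. by apply: eq_bigr => k _; rewrite imag_real. Qed.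

Lemma modesN N k : (- k \in modes N) = (k \in modes N).
Proof. by rewrite !mem_modes/= !normrN. Qed.

Lemma sum_modes_opp (V : nmodType) N (F : int * int -> V) :
  \sum_(k <- modes N) F (- k) = \sum_(k <- modes N) F k.
Proof.
rewrite -(big_map -%R xpredT F); apply: perm_big; apply: uniq_perm.
- by rewrite map_inj_uniq ?uniq_modes//; exact: oppr_inj.
- exact: uniq_modes.
- move=> k; apply/mapP/idP => [[l lN ->]|kN]; first by rewrite modesN.
  by exists (- k); rewrite ?opprK ?modesN.
Qed.

Lemma sum_modes_delta N m (G : int * int -> C) :
  \sum_(k <- modes N) G k * (k == m)%:R = if m \in modes N then G m else 0.
Proof.
case: ifPn => mN.
  rewrite (bigD1_seq m) ?uniq_modes//= eqxx mulr1 big1 ?addr0// => k.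
  by move=> /negPf ->; rewrite mulr0.
rewrite big_seq big1// => k kN; case: eqP => [km|]; last by rewrite mulr0.
by rewrite -km kN in mN.
Qed.

Lemma has_Cintegral_coef N c m :
  has_Cintegral (fun x => trigpoly N c x * wave (- m) x)
           (area * (if m \in modes N then c m else 0)).
Proof.
rewrite -(sum_modes_delta N m c) mulr_sumr.
under [X in has_Cintegral X]funext do rewrite trigpolyE mulr_suml.
apply: has_Cintegral_sum => k _.
rewrite mulrCA -subr_eq0.
under [X in has_Cintegral X]funext do rewrite -mulrA -waveD.
by apply: has_CintegralZ; exact: has_Cintegral_wave.
Qed.

Lemma trigpoly_inj N c d : (forall x, trigpoly N c x = trigpoly N d x) ->
  {in modes N, c =1 d}.
Proof.
move=> cd k kN; apply: (mulfI area_neq0).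
have := has_Cintegral_coef N c k; have := has_Cintegral_coef N d k; rewrite kN.
under [X in has_Cintegral X]funext do rewrite -cd.
by move=> h1 h2; exact: has_Cintegral_uniq h2 h1.
Qed.

Lemma conjcM (z w : C) : conjc (z * w) = conjc z * conjc w.
Proof. exact: rmorphM. Qed.

Lemma conjc_sum (I : Type) (r : seq I) (P : pred I) (F : I -> C) :
  conjc (\sum_(i <- r | P i) F i) = \sum_(i <- r | P i) conjc (F i).
Proof. exact: rmorph_sum. Qed.

Lemma conjc_wave k (x : R * R) : conjc (wave k x) = wave (- k) x.
Proof. by rewrite !waveE dotkN cosN sinN. Qed.

Lemma conjc_trigpoly N c x :
  conjc (trigpoly N c x) = trigpoly N (fun k => conjc (c (- k))) x.
Proof.
rewrite !trigpolyE conjc_sum -sum_modes_opp; apply: eq_bigr => k _.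
by rewrite conjcM conjc_wave opprK.
Qed.

Lemma Im0_conjc (z : C) : Im z = 0 <-> conjc z = z.
Proof.
case: z => a b /=; split=> [->|[/eqP]]; first by rewrite oppr0.
by rewrite eq_sym -addr_eq0 -mulr2n mulrn_eq0/= => /eqP.
Qed.

(** The Hermitian symmetry of the coefficients of a real function, which turns
    the membership in [XN] into an algebraic condition. *)
Lemma XN_hermitian N c : XN N c <->
  (forall k, k \notin modes N -> c k = 0) /\ (forall k, c (- k) = conjc (c k)).
Proof.
split=> [[c0 cr]|[c0 cj]]; split=> //.
  move=> k; have [kN|kN] := boolP (k \in modes N); last first.
    by rewrite !c0 ?modesN// conjc0.
  rewrite -[LHS]conjcK; congr conjc; symmetry.
  apply: (@trigpoly_inj N c (fun k => conjc (c (- k))) _ k kN) => x.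
  by rewrite -conjc_trigpoly; symmetry; apply/Im0_conjc; exact: cr.
move=> x; apply/Im0_conjc; rewrite conjc_trigpoly !trigpolyE.
by apply: eq_bigr => k _; rewrite cj conjcK.
Qed.

Lemma poly_ofE N c x : XN N c -> Complex (poly_of N c x) 0 = trigpoly N c x.
Proof. by move=> [_ /(_ x) c0]; apply: complex_eq. Qed.

Lemma fourier_poly_of N c k : XN N c -> fourier (poly_of N c) k = c k.
Proof.
move=> cX; have [[[_ h1] [_ h2]]] : has_Cintegral (fun x => trigpoly N c x * wave (- k) x)
    (area * c k).
  have := has_Cintegral_coef N c k; case: ifPn => // kN.
  by have [-> //] := cX.
rewrite /fourier /Cintegral.
have E x : (@real_complex_def _ (Phant R) (poly_of N c x)) *
    cexp (- Complex 0 1 * (@real_complex_def _ (Phant R) (dotk k x))) =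
  trigpoly N c x * wave (- k) x.
  rewrite [X in X * _ = _](poly_ofE x cX) /wave dotkN mulNr imag_real.
  by congr (_ * cexp _); apply: complex_eq; rewrite /= ?oppr0.
under eq_Rintegral do rewrite E.
under [X in Complex _ X]eq_Rintegral do rewrite E.
rewrite h1 h2; transitivity (area^-1 * (area * c k)); last first.
  by rewrite mulrA mulVf ?mul1r// area_neq0.
congr (_ * _); last by case: (area * c k).
exact: (fmorphV (real_complex R)).
Qed.

Lemma XND N c d : XN N c -> XN N d -> XN N (c + d).
Proof.
move=> /XN_hermitian[c0 cj] /XN_hermitian[d0 dj]; apply/XN_hermitian.
split=> k; first by move=> kN; rewrite !fctE c0// d0// addr0.
by rewrite !fctE cj dj rmorphD.
Qed.

Lemma XNZ N c (r : R) : XN N c -> XN N ((@real_complex_def _ (Phant R) r) *: c).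
Proof.
move=> /XN_hermitian[c0 cj]; apply/XN_hermitian.
split=> k; first by move=> kN; rewrite !fctE c0// scaler0.
by rewrite !fctE cj /GRing.scale/= conjcM/= oppr0.
Qed.

Lemma XNB N c d : XN N c -> XN N d -> XN N (c - d).
Proof.
move=> cX dX; have -> : c - d = c + (@real_complex_def _ (Phant R) (-1)) *: d.
  apply/funext => k; rewrite !fctE; congr (_ + _).
  by apply: complex_eq; rewrite /GRing.scale/= ?Re_mul ?Im_mul;
    case: (d k) => ? ? /=; ring.
by apply: XND => //; exact: XNZ.
Qed.

(** ** The quadratic nonlinearity in Fourier variables *)

Definition conv N c d k : C :=
  \sum_(p <- modes N | k - p \in modes N) c p * d (k - p).

Definition bil N c d : coefs := fun k =>
  if k \in modes N then Complex 0 (- k.1%:~R / 2) * conv N c d k else 0.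

Lemma conv_sym_sum (V : nmodType) N m (F : int * int -> V) :
  \sum_(p <- modes N | m - p \in modes N) F (m - p) =
  \sum_(p <- modes N | m - p \in modes N) F p.
Proof.
rewrite -big_filter -(big_map (fun p => m - p) xpredT F) -[RHS]big_filter.
have invol p : m - (m - p) = p by rewrite opprB addrC subrK.
apply: perm_big; apply: uniq_perm.
- by rewrite map_inj_uniq ?filter_uniq ?uniq_modes//; exact: (can_inj (g := fun p => m - p) invol).
- by rewrite filter_uniq ?uniq_modes.
- move=> p; rewrite mem_filter; apply/mapP/andP => [[q]|[h1 h2]].
    by rewrite mem_filter => /andP[h1 h2] ->; rewrite invol.
  by exists (m - p); rewrite ?mem_filter ?invol ?h1 ?h2.
Qed.

Lemma convC N c d k : conv N c d k = conv N d c k.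
Proof.
rewrite /conv -conv_sym_sum; apply: eq_bigr => p _.
by rewrite mulrC opprB addrC subrK.
Qed.

Lemma bilC N c d : bil N c d = bil N d c.
Proof. by apply/funext => k; rewrite /bil convC. Qed.

Lemma XN_bil N c d : XN N c -> XN N d -> XN N (bil N c d).
Proof.
move=> /XN_hermitian[c0 cj] /XN_hermitian[d0 dj]; apply/XN_hermitian.
split=> k; first by move=> /negPf kN; rewrite /bil kN.
rewrite /bil modesN; case: ifP => _; last by rewrite conjc0.
rewrite conjcM; congr (_ * _).
  by apply: complex_eq; rewrite /= ?oppr0// rmorphN/= opprK mulNr opprK.
rewrite /conv conjc_sum big_mkcond -sum_modes_opp [RHS]big_mkcond.
apply: eq_bigr => p _.
rewrite -opprD modesN; case: ifP => // _.
by rewrite cj dj conjcM.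
Qed.

Definition dtrig c : coefs := fun k => Complex 0 k.1%:~R * c k.

Lemma XN_dtrig N c : XN N c -> XN N (dtrig c).
Proof.
move=> /XN_hermitian[c0 cj]; apply/XN_hermitian.
split=> k; first by move=> kN; rewrite /dtrig c0// mulr0.
rewrite /dtrig cj conjcM; congr (_ * _).
by apply: complex_eq; rewrite /= ?oppr0// rmorphN.
Qed.

Lemma is_derive_poly_of N c (x : R * R) :
  is_derive x.1 1 (fun s => poly_of N c (s, x.2)) (poly_of N (dtrig c) x).
Proof.
case: x => x y /=; pose a := x - 1; pose b := x + 1.
have xab : x \in `]a, b[ by rewrite in_itv/= /a /b; apply/andP; split; lra.
have : has_cderiv a b (fun s => trigpoly N c (s, y))
    (fun s => trigpoly N (dtrig c) (s, y)).
  under [X in has_cderiv _ _ X]funext do rewrite trigpolyE.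
  under [X in has_cderiv _ _ _ X]funext do rewrite trigpolyE.
  apply: has_cderiv_sum => k _.
  have wE s : wave k (s, y) =
      wave (0, k.2) (0, y) * cexp (Complex 0 (k.1%:~R * s)).
    rewrite !waveE cexp_imag /dotk/= !mul0r !add0r addrC cosD sinD.
    by apply: complex_eq; rewrite ?Re_mul ?Im_mul/=; ring.
  have d := has_cderivMl (wave (0, k.2) (0, y)) (@has_cderiv_cexp _ a b k.1%:~R).
  apply: (eq_has_cderiv _ _ (has_cderivMl (c k) d)).
    by move=> s; rewrite wE.
  by move=> s _; rewrite wE /dtrig; ring.
by move=> [_ _ /(_ _ xab)[]].
Qed.

Lemma dx1_sqr N c (x : R * R) :
  dx1 (fun x => poly_of N c x ^+ 2) x =
  2 * (poly_of N c x * poly_of N (dtrig c) x).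
Proof.
rewrite /dx1 derive1E.
have d := is_deriveM (is_derive_poly_of N c x) (is_derive_poly_of N c x).
have e := @derive_val _ _ _ _ _ _ _ d.
pose F (s : R) := poly_of N c (s, x.2).
have FE : (fun s => F s ^+ 2) = F * F.
  by apply/funext => s; rewrite fctE expr2.
transitivity ('D_1 (F * F) x.1); first by rewrite -FE.
by rewrite [LHS]e /GRing.scale; case: (x) => ? ? /=; ring.
Qed.

(** A projection is determined by the integrals against the waves of [XN]: testing
    the orthogonality relation with the difference of two candidates yields the
    sum of the squared moduli of its coefficients. *)
Lemma PiN_eq N (f : R * R -> R) (fh : coefs) : XN N fh ->
  (forall m, m \in modes N ->
    has_Cintegral (fun x => Complex (f x) 0 * wave (- m) x) (area * fh m)) ->
  PiN N f = fh.
Proof.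
move=> fX fm.
have key c d : XN N c -> XN N d ->
    \int[mu2]_(x in Omega) ((f x - poly_of N c x) * poly_of N d x) =
    Re (area * \sum_(m <- modes N) d (- m) * (fh m - c m)).
  move=> cX dX.
  suff [[_ <-] _] : has_Cintegral
      (fun x => Complex ((f x - poly_of N c x) * poly_of N d x) 0)
      (area * \sum_(m <- modes N) d (- m) * (fh m - c m)) by [].
  have E x : Complex ((f x - poly_of N c x) * poly_of N d x) 0 =
      \sum_(m <- modes N) d (- m) * (Complex (f x) 0 * wave (- m) x +
         (-1) * (trigpoly N c x * wave (- m) x)).
    transitivity ((Complex (f x) 0 - trigpoly N c x) * trigpoly N d x).
      rewrite -(poly_ofE x cX) -(poly_ofE x dX).
      by apply: complex_eq; rewrite ?Re_mul ?Im_mul/=; ring.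
    rewrite [X in _ * X]trigpolyE -sum_modes_opp mulr_sumr.
    by apply: eq_bigr => m _; ring.
  under [X in has_Cintegral X]funext do rewrite E.
  rewrite mulr_sumr !big_seq.
  under [X in has_Cintegral X]funext do rewrite big_seq.
  apply: has_Cintegral_sum => m mN.
  have -> : area * (d (- m) * (fh m - c m)) =
      d (- m) * (area * fh m + (-1) * (area * c m)) by ring.
  apply: has_CintegralZ; apply: has_CintegralD; first exact: fm.
  by apply: has_CintegralZ; have := has_Cintegral_coef N c m; rewrite mN.
apply: xget_unique => [|c [cX corth]].
  split=> // d dX; rewrite key// big1 ?mulr0// => m _.
  by rewrite subrr mulr0.
have dX := XNB fX cX; have := corth _ dX; rewrite key// => S0.
have {}S0 : \sum_(m <- modes N) Normc.normc ((fh - c) m) ^+ 2 = 0.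
  apply: (mulfI (x := (2 * pi) ^+ 2)).
    by rewrite expf_neq0// mulf_neq0// gt_eqF// pi_gt0.
  rewrite mulr0 -[RHS]S0 Re_mul/= mul0r subr0; congr (_ * _).
  rewrite Re_sum; apply: eq_bigr => m _.
  have /XN_hermitian[_ ->] := dX.
  rewrite sqr_normcE Re_mul !fctE; case: (fh m - c m) => u v /=; ring.
apply/funext => k; have [kN|kN] := boolP (k \in modes N); last first.
  by rewrite (proj1 cX)// (proj1 fX).
have := S0 => /eqP; rewrite psumr_eq0; last by move=> m _; rewrite sqr_ge0.
move=> /allP/(_ k kN) /=; rewrite expf_eq0/= => /eqP/Normc.eq0_normc/eqP.
by rewrite !fctE subr_eq0 => /eqP.
Qed.

(** In the product of a polynomial and its derivative, exchanging the two
    interacting frequencies replaces the derivative of one factor by half of the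
    derivative of the product. *)
Lemma Nonlin_bil N c : XN N c -> Nonlin N c = bil N c c.
Proof.
move=> cX; have bX := XN_bil cX cX.
pose r2 := @real_complex_def _ (Phant R) (-2).
have E : r2 *: bil N c c = fun k =>
    if k \in modes N then Complex 0 k.1%:~R * conv N c c k else 0.
  apply/funext => k; rewrite !fctE /bil; case: ifP => _; last by rewrite scaler0.
  rewrite /GRing.scale/= mulrA; congr (_ * _).
  by apply: complex_eq; rewrite ?Re_mul ?Im_mul/=; field.
rewrite /Nonlin (@PiN_eq _ _ (r2 *: bil N c c)).
- apply/funext => k; rewrite !fctE; case: (bil N c c k) => u v.
  by rewrite /GRing.scale/=; apply: complex_eq; rewrite ?Re_mul ?Im_mul/=; field.
- exact: XNZ.
move=> m mN; rewrite E mN.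
have F x : Complex (dx1 (fun x => poly_of N c x ^+ 2) x) 0 * wave (- m) x =
    \sum_(p <- modes N) \sum_(r <- modes N)
       2 * (c p * dtrig c r) * wave (p + r - m) x.
  rewrite dx1_sqr; transitivity (2 * (trigpoly N c x * trigpoly N (dtrig c) x) * wave (- m) x).
    rewrite -(poly_ofE x cX) -(poly_ofE x (XN_dtrig cX)); congr (_ * _).
    by apply: complex_eq; rewrite ?Re_mul ?Im_mul/=; ring.
  rewrite !trigpolyE mulr_suml mulr_sumr mulr_suml; apply: eq_bigr => p _.
  rewrite mulr_sumr mulr_sumr mulr_suml; apply: eq_bigr => r _.
  by rewrite !waveD; ring.
under [X in has_Cintegral X]funext do rewrite F.
have -> : area * (Complex 0 m.1%:~R * conv N c c m) =
    \sum_(p <- modes N) \sum_(r <- modes N)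
       2 * (c p * dtrig c r) * (area * (p + r - m == 0)%:R).
  transitivity (area * \sum_(p <- modes N | m - p \in modes N)
      2 * (c p * dtrig c (m - p))).
    congr (_ * _); rewrite -mulr_sumr mulr_natl mulr2n.
    rewrite -[X in _ = X + _](conv_sym_sum N m (fun p => c p * dtrig c (m - p))).
    rewrite -big_split/= mulr_sumr; apply: eq_bigr => p _.
    have -> : m - (m - p) = p by rewrite opprB addrC subrK.
    rewrite /dtrig.
    have -> : Complex 0 (m.1%:~R : R) =
        Complex 0 (p.1%:~R) + Complex 0 ((m - p).1%:~R).
      by apply: complex_eq; rewrite /= ?rmorphB/=; ring.
    by ring.
  rewrite mulr_sumr big_mkcond; apply: eq_bigr => p _.
  have D r : (p + r - m == 0) = (r == m - p).
    by rewrite subr_eq0 addrC eq_sym -subr_eq eq_sym.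
  rewrite -(sum_modes_delta N (m - p) (fun r => area * (2 * (c p * dtrig c r)))).
  by apply: eq_bigr => r _; rewrite D; ring.
apply: has_Cintegral_sum => p _; apply: has_Cintegral_sum => r _.
by apply: has_CintegralZ; exact: has_Cintegral_wave.
Qed.

End FourierCoefficients.

(** * Weighted norms of coefficient families *)

Section WeightedNorms.
Context {R : realType}.
Local Notation C := (complex R).
Local Notation Re := (@complex.Re R).
Local Notation Im := (@complex.Im R).
Local Notation nc := Normc.normc.
Local Notation Omega := (@Omega R).
Local Notation coefs := (@coefs R).
Local Notation mu2 := (@lebesgue_measure R \x @lebesgue_measure R)%E.

Definition weight (k : int * int) : R := 1 + `|k.1%:~R| + `|k.2%:~R|.

Lemma weight_ge1 k : 1 <= weight k.
Proof. by rewrite /weight -addrA lerDl addr_ge0. Qed.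

Lemma weight_gt0 k : 0 < weight k.
Proof. exact: lt_le_trans (weight_ge1 k). Qed.

Lemma weightD k l : weight (k + l) <= weight k * weight l.
Proof.
rewrite /weight /= !rmorphD/=.
have := ler_normD (k.1%:~R : R) l.1%:~R; have := ler_normD (k.2%:~R : R) l.2%:~R.
have := normr_ge0 (k.1%:~R : R); have := normr_ge0 (l.1%:~R : R).
have := normr_ge0 (k.2%:~R : R); have := normr_ge0 (l.2%:~R : R).
set a := `|k.1%:~R|; set b := `|k.2%:~R|; set c := `|l.1%:~R|.
set d := `|l.2%:~R|; set e := `|_ + _|; set f := `|_ + _|.
move=> *; have : 0 <= a * c by apply: mulr_ge0.
have : 0 <= a * d by apply: mulr_ge0.
have : 0 <= b * c by apply: mulr_ge0.
have : 0 <= b * d by apply: mulr_ge0.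
by move=> *; lra.
Qed.

Lemma sqk_ge0 k : 0 <= sqk k :> R.
Proof. by rewrite addr_ge0 ?sqr_ge0. Qed.

Lemma sqrt_sqk_le_weight k : Num.sqrt (sqk k) <= weight k.
Proof.
rewrite -[weight k]ger0_norm ?(ltW (weight_gt0 k))// -sqrtr_sqr.
apply: ler_wsqrtr; rewrite /sqk /weight.
rewrite -(real_normK (num_real k.1%:~R)) -(real_normK (num_real k.2%:~R)).
have := normr_ge0 (k.1%:~R : R); have := normr_ge0 (k.2%:~R : R).
set a := `|k.1%:~R|; set b := `|k.2%:~R| => *.
have : 0 <= a * b by apply: mulr_ge0.
by move=> *; lra.
Qed.

Lemma sqr_weight_le k : weight k ^+ 2 <= 3 * (1 + sqk k).
Proof.
rewrite /sqk /weight.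
rewrite -(real_normK (num_real k.1%:~R)) -(real_normK (num_real k.2%:~R)).
set a := `|k.1%:~R|; set b := `|k.2%:~R|.
have := sqr_ge0 (a - b); have := sqr_ge0 (a - 1); have := sqr_ge0 (b - 1).
by move=> *; lra.
Qed.

(** The order [1 + alpha] of the linear part dominates both the symbol of [L]
    and the single derivative of the nonlinearity, so that one power of [grade]
    accounts for either loss. *)
Definition grade (alpha : R) (k : int * int) : R := weight k `^ (1 + alpha).

Lemma grade_ge1 alpha k : 0 < alpha -> 1 <= grade alpha k.
Proof.
move=> a0; apply: le_trans (weight_ge1 k) _.
by apply: le1r_powR; rewrite ?weight_ge1// lerDl ltW.
Qed.

Lemma grade_ge0 alpha k : 0 <= grade alpha k.
Proof. exact: powR_ge0. Qed.

Lemma gradeD alpha k l : 0 < alpha ->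
  grade alpha (k + l) <= grade alpha k * grade alpha l.
Proof.
move=> a0; rewrite -powRM ?(ltW (weight_gt0 _))//.
apply: ge0_ler_powR; rewrite ?nnegrE ?mulr_ge0 ?(ltW (weight_gt0 _))//.
  by rewrite addr_ge0 ?ltW.
exact: weightD.
Qed.

Lemma norm_fst_le_grade alpha k : 0 < alpha -> `|k.1%:~R| <= grade alpha k.
Proof.
move=> a0; apply: (@le_trans _ _ (weight k)).
  by rewrite /weight [1 + _]addrC -addrA lerDl addr_ge0.
by apply: le1r_powR; rewrite ?weight_ge1// lerDl ltW.
Qed.

Definition freq (alpha : R) (k : int * int) : R :=
  k.1%:~R * Num.sqrt (sqk k) `^ alpha.

Lemma LsymE alpha k : Lsym alpha k = Complex 0 (freq alpha k).
Proof. by rewrite /Lsym imag_real. Qed.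

Lemma normc_Lsym_le alpha k : 0 < alpha -> nc (Lsym alpha k) <= grade alpha k.
Proof.
move=> a0; rewrite LsymE normc_imag normrM /grade powRD; last first.
  by rewrite gt_eqF ?addr_gt0.
rewrite powRr1 ?(ltW (weight_gt0 k))//; apply: ler_pM => //.
  by rewrite /weight [1 + _]addrC -addrA lerDl addr_ge0.
rewrite ger0_norm ?powR_ge0//; apply: ge0_ler_powR; rewrite ?nnegrE ?sqrtr_ge0 ?(ltW a0)//.
  exact: ltW (weight_gt0 k).
exact: sqrt_sqk_le_weight.
Qed.

(** A graded scale of Wiener algebras; the exponent counts how many orders of
    the linear part are controlled. *)
Definition wnorm (alpha : R) (N i : nat) (c : coefs) : R :=
  \sum_(k <- modes N) grade alpha k ^+ i * nc (c k).

Section Wnorm.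
Variables (alpha : R) (N : nat).
Hypothesis alpha0 : 0 < alpha.
Local Notation nrm := (wnorm alpha N).
Implicit Types (c d : coefs) (i : nat).

Let gr0 k : 0 <= grade alpha k := grade_ge0 alpha k.
Let gr1 k : 1 <= grade alpha k := grade_ge1 k alpha0.

Lemma wnorm_ge0 i c : 0 <= nrm i c.
Proof. by apply: sumr_ge0 => k _; rewrite mulr_ge0 ?exprn_ge0 ?normc_ge0. Qed.

Lemma wnormS i c : nrm i c <= nrm i.+1 c.
Proof.
apply: ler_sum => k _; apply: ler_wpM2r; first exact: normc_ge0.
by rewrite exprS ler_peMl ?exprn_ge0.
Qed.

Lemma wnorm_leq i j c : (i <= j)%N -> nrm i c <= nrm j c.
Proof.
elim: j => [|j IH]; first by rewrite leqn0 => /eqP ->.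
by rewrite leq_eqVlt => /predU1P[->//|/IH]; move/le_trans; apply; exact: wnormS.
Qed.

Lemma wnormD i c d : nrm i (c + d) <= nrm i c + nrm i d.
Proof.
rewrite -big_split/=; apply: ler_sum => k _.
by rewrite -mulrDr; apply: ler_wpM2l; [exact: exprn_ge0|exact: le_normcD].
Qed.

Lemma wnormZ i (r : R) c : nrm i (Complex r 0 *: c) = `|r| * nrm i c.
Proof.
rewrite /wnorm mulr_sumr; apply: eq_bigr => k _.
by rewrite !fctE Normc.normcM normc_real; ring.
Qed.

Lemma wnormN i c : nrm i (- c) = nrm i c.
Proof. by apply: eq_bigr => k _; rewrite !fctE normcN. Qed.

Lemma wnormB i c d : nrm i (c - d) <= nrm i c + nrm i d.
Proof. by apply: le_trans (wnormD _ _ _) _; rewrite wnormN. Qed.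

Lemma wnorm_expL i t c : nrm i (expL alpha t c) = nrm i c.
Proof.
apply: eq_bigr => k _; rewrite /expL LsymE Normc.normcM.
have -> : Complex 0 (freq alpha k) * (@real_complex_def _ (Phant R) t) =
    Complex 0 (freq alpha k * t).
  by apply: complex_eq; rewrite ?Re_mul ?Im_mul/=; ring.
by rewrite normc_cexp_imag mul1r.
Qed.

Lemma wnorm_Lop i c : nrm i (Lop alpha c) <= nrm i.+1 c.
Proof.
apply: ler_sum => k _; rewrite /Lop Normc.normcM exprSr mulrA.
apply: ler_wpM2r; first exact: normc_ge0.
by apply: ler_wpM2l; [exact: exprn_ge0|exact: normc_Lsym_le].
Qed.

(** The Wiener algebra property: the weight of a frequency is at most the
    product of the weights of the two frequencies that interact to form it. *)
Lemma wnorm_bil i c d : nrm i (bil N c d) <= nrm i.+1 c * nrm i.+1 d.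
Proof.
pose a c k := grade alpha k ^+ i.+1 * nc (c k : C).
have a0 c' k : 0 <= a c' k by rewrite /a mulr_ge0 ?exprn_ge0 ?normc_ge0.
apply: (@le_trans _ _ (\sum_(k <- modes N)
    \sum_(p <- modes N | k - p \in modes N) a c p * a d (k - p))).
  rewrite /wnorm !big_seq; apply: ler_sum => k kN.
  rewrite /bil kN Normc.normcM normc_imag mulrA.
  have le1 : grade alpha k ^+ i * `|- k.1%:~R / 2| <= grade alpha k ^+ i.+1.
    rewrite exprSr; apply: ler_wpM2l; first exact: exprn_ge0.
    apply: le_trans (norm_fst_le_grade k alpha0).
    rewrite normrM normrN ler_piMr// ger0_norm// invf_le1//.
    by rewrite ler1n.
  apply: (@le_trans _ _ (grade alpha k ^+ i.+1 * nc (conv N c d k))).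
    by apply: ler_wpM2r => //; exact: normc_ge0.
  apply: (@le_trans _ _ (grade alpha k ^+ i.+1 *
      \sum_(p <- modes N | k - p \in modes N) nc (c p * d (k - p)))).
    by apply: ler_wpM2l; [exact: exprn_ge0|exact: le_normc_sum].
  rewrite mulr_sumr; apply: ler_sum => p _.
  rewrite Normc.normcM /a mulrACA; apply: ler_wpM2r.
    by rewrite mulr_ge0 ?normc_ge0.
  rewrite -exprMn; apply: lerXn2r; rewrite ?nnegrE ?mulr_ge0//.
  by have := gradeD p (k - p) alpha0; rewrite addrC subrK.
under eq_bigr do rewrite big_mkcond.
rewrite exchange_big mulr_suml; apply: ler_sum => p _ /=.
rewrite -big_mkcond -mulr_sumr; apply: ler_wpM2l => //.
rewrite -big_filter -(big_map (fun k => k - p) xpredT (a d)).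
set s := map _ _.
have us : uniq s.
  by rewrite map_inj_uniq ?filter_uniq ?uniq_modes// => x y /addIr.
have ss : {subset s <= modes N}.
  by move=> q /mapP[k]; rewrite mem_filter => /andP[kp _] ->.
have ps : perm_eq s [seq q <- modes N | q \in s].
  apply: uniq_perm; rewrite ?filter_uniq ?uniq_modes// => q.
  by rewrite mem_filter; case qs: (q \in s) => //=; rewrite ss.
apply: (@le_trans _ _ (\sum_(q <- modes N | q \in s) a d q)).
  by rewrite (perm_big _ ps) -[leRHS]big_filter.
rewrite big_mkcond; apply: ler_sum => q _.
by case: ifP => // _; exact: a0.
Qed.

End Wnorm.

(** ** Comparison with the Sobolev and Lebesgue norms *)

Lemma sum_inv_1sqr_freqs N : \sum_(j <- freqs N) (1 + j%:~R ^+ 2)^-1 <= 8 :> R.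
Proof.
(* The summand is at most four times the increment of the bounded odd function
   n / (1 + |n|), over a step that points away from the origin. *)
pose g (j : int) : R := j%:~R / (1 + `|j%:~R|).
have gle1 j : `|g j| <= 1.
  rewrite /g normrM normfV [X in _ / X]ger0_norm ?addr_ge0// ler_pdivrMr ?ltr_pwDl//.
  by rewrite mul1r lerDr.
have step (j : int) : (1 + j%:~R ^+ 2)^-1 <= 4 * (g (j + 1) - g j).
  have aux (x : R) : 0 <= x ->
      (1 + x ^+ 2)^-1 <= 4 / ((x + 1) * (x + 2)) /\
      (1 + (x + 1) ^+ 2)^-1 <= 4 / ((x + 1) * (x + 2)).
    move=> x0; have p0 : 0 < (x + 1) * (x + 2) by rewrite mulr_gt0// ltr_wpDl.
    have := sqr_ge0 (x - 2^-1) => h.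
    split; rewrite ler_pdivlMr// mulrC ler_pdivrMr ?ltr_pwDl ?sqr_ge0//; nra.
  have gE (x : R) : 0 <= x -> (x + 1) / (1 + (x + 1)) - x / (1 + x) =
      ((x + 1) * (x + 2))^-1.
    by move=> x0; field; apply/andP; split; apply: lt0r_neq0; lra.
  case: j => n; rewrite /g ?NegzE.
    have n0 : 0 <= n%:R :> R by [].
    rewrite rmorphD/= -pmulrn ger0_norm ?addr_ge0// ger0_norm// gE//.
    exact: (aux _ n0).1.
  have n0 : 0 <= n%:R :> R by [].
  have e1 : (- n.+1%:Z + 1)%:~R = - n%:R :> R.
    by rewrite rmorphD/= rmorphN/= -!pmulrn -natr1; ring.
  have e2 : (- n.+1%:Z)%:~R = - (n%:R + 1) :> R.
    by rewrite rmorphN/= -pmulrn -natr1.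
  rewrite e1 e2 !normrN sqrrN ger0_norm// ger0_norm ?addr_ge0//.
  have -> : - n%:R / (1 + n%:R) - - (n%:R + 1) / (1 + (n%:R + 1)) =
      ((n%:R + 1) * (n%:R + 2))^-1 :> R by rewrite -gE//; ring.
  exact: (aux _ n0).2.
have tele m : \sum_(i <- iota 0 m) (1 + (i%:Z - N%:Z)%:~R ^+ 2)^-1 <=
    4 * (g (m%:Z - N%:Z) - g (0 - N%:Z)).
  elim: m => [|m IH]; first by rewrite big_nil subrr mulr0.
  rewrite -addn1 iotaD big_cat/= big_seq1 add0n.
  have := step (m%:Z - N%:Z); rewrite PoszD addrAC.
  by move=> h; lra.
rewrite /freqs big_map; apply: le_trans (tele _) _.
have := gle1 ((2 * N).+1%:Z - N%:Z); have := gle1 (0 - N%:Z).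
by rewrite !ler_norml => /andP[h1 h2] /andP[h3 h4]; lra.
Qed.

Lemma sum_inv_sqr_1sqk N : \sum_(k <- modes N) (1 + sqk k) ^- 2 <= 64 :> R.
Proof.
pose s (j : int) : R := (1 + j%:~R ^+ 2)^-1.
have s0 j : 0 <= s j by rewrite invr_ge0 addr_ge0 ?sqr_ge0.
have S0 : 0 <= \sum_(j <- freqs N) s j by apply: sumr_ge0.
apply: (@le_trans _ _ ((\sum_(j <- freqs N) s j) ^+ 2)); last first.
  have -> : 64 = 8 ^+ 2 :> R by rewrite expr2 -natrM.
  by apply: lerXn2r; rewrite ?nnegrE// sum_inv_1sqr_freqs.
rewrite /modes big_allpairs expr2 mulr_suml; apply: ler_sum => j1 _.
rewrite mulr_sumr; apply: ler_sum => j2 _; rewrite /s -invfM.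
have h1 := sqr_ge0 (j1%:~R : R); have h2 := sqr_ge0 (j2%:~R : R).
rewrite lef_pV2 ?posrE ?exprn_gt0 ?mulr_gt0 ?ltr_pwDl ?sqk_ge0//.
by rewrite /sqk /=; nra.
Qed.

Definition grade_bound (alpha Rad : R) : R :=
  (3 `^ (5 * (1 + alpha)) * 64 + Rad ^+ 2) / 2.

Lemma grade_bound_ge0 alpha Rad : 0 <= grade_bound alpha Rad.
Proof.
by rewrite /grade_bound mulr_ge0 ?invr_ge0 ?addr_ge0 ?sqr_ge0 ?mulr_ge0 ?powR_ge0.
Qed.

Lemma sum_le_Hnorm q N c (Rad : R) : XN N c -> 0 <= Rad ->
  (Hnorm q (poly_of N c) <= Rad%:E)%E ->
  \sum_(k <- modes N) (1 + sqk k) `^ q * nc (c k) ^+ 2 <= Rad ^+ 2.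
Proof.
move=> cX Rad0; rewrite /Hnorm.
pose F k := ((1 + sqk k) `^ q * nc (fourier (poly_of N c) k) ^+ 2)%:E.
have F0 k : (0 <= F k)%E by rewrite lee_fin mulr_ge0 ?powR_ge0 ?sqr_ge0.
rewrite -/F; have E0 : (0 <= \esum_(k in [set: int * int]) F k)%E by apply: esum_ge0 => k _; exact: F0.
have : ((\sum_(k <- modes N) (1 + sqk k) `^ q * nc (c k) ^+ 2)%:E <=
    \esum_(k in [set: int * int]) F k)%E.
  apply: esum_ge; exists [set` modes N]; first by split; [exact: finite_seq|].
  rewrite -fsbig_seq ?uniq_modes// sumEFin lee_fin.
  by apply: ler_sum => k _; rewrite fourier_poly_of.
move=> le1; rewrite poweR12_sqrt// => le2.
move: le1 le2 E0; case: (esum _ _) => [r| |]//; rewrite !lee_fin => le1 le2 r0.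
apply: le_trans le1 _; rewrite -[r]sqr_sqrtr//.
by apply: lerXn2r; rewrite ?nnegrE ?sqrtr_ge0.
Qed.

(** The embedding of the Sobolev space into the fifth term of the scale: the
    excess regularity [q - 5 (1 + alpha) > 2] pays for a sum over the lattice. *)
Lemma wnorm5_le_Hnorm alpha q N c (Rad : R) : 0 < alpha <= 2 ->
  4 * (1 + alpha) + 5 < q -> XN N c -> 0 <= Rad ->
  (Hnorm q (poly_of N c) <= Rad%:E)%E ->
  wnorm alpha N 5 c <= grade_bound alpha Rad.
Proof.
move=> /andP[a0 a2] hq cX Rad0 /(sum_le_Hnorm cX Rad0) leR.
pose b k := (1 + sqk k) `^ q.
have sk1 k : 1 <= 1 + sqk k :> R by rewrite lerDl sqk_ge0.
have b0 k : 0 < b k by rewrite powR_gt0// (lt_le_trans _ (sk1 k)).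
(* The arithmetic-geometric mean inequality plays the part of Cauchy-Schwarz:
   constants only have to depend on the radius. *)
have amgm k : grade alpha k ^+ 5 * nc (c k) <=
    (grade alpha k ^+ 10 / b k + b k * nc (c k) ^+ 2) / 2.
  rewrite ler_pdivlMr// -subr_ge0.
  have -> : grade alpha k ^+ 10 / b k + b k * nc (c k) ^+ 2 -
      grade alpha k ^+ 5 * nc (c k) * 2 =
      b k * (grade alpha k ^+ 5 / b k - nc (c k)) ^+ 2.
    by field; rewrite gt_eqF.
  by rewrite mulr_ge0 ?sqr_ge0// ltW.
apply: le_trans (ler_sum _ (fun k _ => amgm k)) _.
rewrite -mulr_suml ler_pM2r// big_split/= lerD//.
apply: (@le_trans _ _ (\sum_(k <- modes N)
    3 `^ (5 * (1 + alpha)) * (1 + sqk k) ^- 2)); last first.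
  by rewrite -mulr_sumr ler_wpM2l ?powR_ge0 ?sum_inv_sqr_1sqk.
apply: ler_sum => k _.
have -> : grade alpha k ^+ 10 = (weight k ^+ 2) `^ (5 * (1 + alpha)).
  rewrite -(powR_mulrn 10) ?grade_ge0// -powRrM.
  rewrite -(powR_mulrn 2) ?(ltW (weight_gt0 k))// -powRrM.
  by congr (_ `^ _); ring.
apply: (@le_trans _ _ ((3 * (1 + sqk k)) `^ (5 * (1 + alpha)) / b k)).
  rewrite ler_pM2r ?invr_gt0//; apply: ge0_ler_powR.
  - by rewrite mulr_ge0// addr_ge0// ltW.
  - by rewrite nnegrE sqr_ge0.
  - by rewrite nnegrE mulr_ge0// (le_trans ler01).
  - exact: sqr_weight_le.
rewrite powRM// ?(le_trans ler01)// -mulrA ler_wpM2l ?powR_ge0//.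
rewrite -[b k]/(powR _ q) -powRN -powRD; last first.
  by rewrite (gt_eqF (lt_le_trans ltr01 (sk1 k))) implybT.
rewrite -powR_invn ?(le_trans ler01)//.
by apply: ler_powR => //; lra.
Qed.

Lemma norm_poly_of_le N (c : coefs) x : `|poly_of N c x| <= \sum_(k <- modes N) nc (c k).
Proof.
apply: le_trans (le_Re_normc _) _; rewrite trigpolyE.
apply: le_trans (le_normc_sum _ _ _) _; apply: ler_sum => k _.
by rewrite Normc.normcM normc_cexp_imag mulr1.
Qed.

Lemma L2norm_le_wnorm alpha N (c : coefs) :
  L2norm (poly_of N c) <= 2 * pi * wnorm alpha N 0 c.
Proof.
set M := \sum_(k <- modes N) nc (c k).
have -> : wnorm alpha N 0 c = M by apply: eq_bigr => k _; rewrite mul1r.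
have M0 : 0 <= M by apply: sumr_ge0 => k _; exact: normc_ge0.
have pi0 : 0 <= 2 * pi :> R by rewrite mulr_ge0// pi_ge0.
have -> : 2 * pi * M = Num.sqrt ((2 * pi * M) ^+ 2).
  by rewrite sqrtr_sqr ger0_norm// mulr_ge0.
apply: ler_wsqrtr.
have [[ip _] _] : has_Cintegral (fun x => trigpoly N c x)
    (\sum_(k <- modes N) c k * (area * (k == 0)%:R)).
  under [X in has_Cintegral X]funext do rewrite trigpolyE.
  by apply: has_Cintegral_sum => k _; apply: has_CintegralZ; exact: has_Cintegral_wave.
have mp : measurable_fun Omega (poly_of N c).
  by apply/measurable_EFinP; have := measurable_int _ ip.
have sqb x : `|poly_of N c x ^+ 2| <= M ^+ 2.
  by rewrite normrX; apply: lerXn2r; rewrite ?nnegrE//; exact: norm_poly_of_le.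
apply: (@le_trans _ _ (\int[mu2]_(x in Omega) (M ^+ 2))).
  apply: le_Rintegral; first exact: measurable_Omega.
  - by apply: bounded_integrable_Omega sqb; exact: measurable_funX.
  - by apply: (@bounded_integrable_Omega _ (fun=> M ^+ 2) (M ^+ 2)) => // x;
      rewrite ger0_norm ?sqr_ge0.
  - by move=> x _; apply: le_trans (ler_norm _) (sqb x).
rewrite Rintegral_cst; last exact: measurable_Omega.
rewrite exprMn mulrC ler_wpM2r ?sqr_ge0//.
suff -> : fine (mu2 Omega) = (2 * pi) ^+ 2 by [].
by rewrite measure_Omega.
Qed.

End WeightedNorms.

(** * Time regularity and Taylor expansion in the graded scale *)

Section TimeRegularity.
Context {R : realType}.
Local Notation C := (complex R).
Local Notation Re := (@complex.Re R).
Local Notation Im := (@complex.Im R).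
Local Notation nc := Normc.normc.
Local Notation coefs := (@coefs R).
Variables (alpha : R) (N : nat).
Hypothesis alpha0 : 0 < alpha.
Local Notation nrm := (wnorm alpha N).
Local Notation B := (bil N).
Implicit Types (f g : R -> coefs) (a b t K : R) (i j : nat).

Definition cdiff a b f f1 : Prop :=
  forall k, has_cderiv a b (fun t => f t k) (fun t => f1 t k).

(** A mean value inequality in the weighted norm. Rotating each component of the
    increment onto the positive axis bounds the norm by a real-valued linear
    functional, to which the mean value theorem applies. *)
Lemma cdiff_mvt a b f f1 i K x y : cdiff a b f f1 ->
  (forall t, t \in `[a, b] -> nrm i (f1 t) <= K) ->
  a <= x -> x <= y -> y <= b -> nrm i (f y - f x) <= K * (y - x).
Proof.
move=> df bf ax xy yb.
have ph k : exists e : C, nc e <= 1 /\ e * (f y - f x) k =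
    Complex (nc ((f y - f x) k)) 0.
  by have [e e1 e2] := exists_phase ((f y - f x) k); exists e.
have [e he] := choice ph.
pose l (c : coefs) : C :=
  \sum_(k <- modes N) (Complex (grade alpha k ^+ i) 0 * e k) * c k.
have dl : has_cderiv x y (fun t => l (f t)) (fun t => l (f1 t)).
  apply: has_cderiv_sum => k _; apply: has_cderivMl.
  exact: has_cderiv_sub ax yb (df k).
have lE : Re (l (f y)) - Re (l (f x)) = nrm i (f y - f x).
  rewrite !Re_sum -sumrB; apply: eq_bigr => k _.
  transitivity (Re (Complex (grade alpha k ^+ i) 0 * (e k * (f y - f x) k))).
    by rewrite !fctE !Re_mul !Im_mul !Re_add !Im_add;
      case: (f x k) => ? ? /=; ring.
  by rewrite (he k).2 Re_mul/= mulr0 subr0.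
have lB c : `|Re (l c)| <= nrm i c.
  apply: le_trans (le_Re_normc _) _; apply: le_trans (le_normc_sum _ _ _) _.
  apply: ler_sum => k _.
  rewrite !Normc.normcM normc_real ger0_norm ?exprn_ge0 ?grade_ge0// -mulrA.
  rewrite ler_wpM2l ?exprn_ge0 ?grade_ge0// ler_piMl ?normc_ge0//.
  exact: (he k).1.
have [cl _ dRe] := dl.
have [z zxy zE] := MVT_segment xy (fun z zxy => (dRe z zxy).1) cl.
rewrite -lE zE ler_wpM2r ?subr_ge0//.
apply: le_trans (ler_norm _) _; apply: le_trans (lB _) (bf _ _).
move: zxy; rewrite !in_itv/= => /andP[h1 h2].
by rewrite (le_trans ax h1) (le_trans h2 yb).
Qed.

Lemma cdiffD a b f g f1 g1 : cdiff a b f f1 -> cdiff a b g g1 ->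
  cdiff a b (fun t => f t + g t) (fun t => f1 t + g1 t).
Proof. by move=> df dg k; exact: has_cderivD (df k) (dg k). Qed.

Lemma cdiffZ a b (r : R) f f1 : cdiff a b f f1 ->
  cdiff a b (fun t => Complex r 0 *: f t) (fun t => Complex r 0 *: f1 t).
Proof. by move=> df k; exact: has_cderivMl (df k). Qed.

Lemma cdiff_Lop a b f f1 : cdiff a b f f1 ->
  cdiff a b (fun t => Lop alpha (f t)) (fun t => Lop alpha (f1 t)).
Proof. by move=> df k; exact: has_cderivMl (df k). Qed.

Lemma cdiff_bil a b f g f1 g1 : cdiff a b f f1 -> cdiff a b g g1 ->
  cdiff a b (fun t => B (f t) (g t)) (fun t => B (f1 t) (g t) + B (f t) (g1 t)).
Proof.
move=> df dg k; rewrite /bil; case: (boolP (k \in modes N)) => [kN|/negPf kN].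
  have d := has_cderivMl (Complex 0 (- k.1%:~R / 2)) (has_cderiv_sum (modes N)
    (fun p (_ : k - p \in modes N) => has_cderivM (df p) (dg (k - p)))).
  apply: eq_has_cderiv d => // t _.
  by rewrite !fctE kN -mulrDr /conv -big_split.
apply: eq_has_cderiv (has_cderiv_cst a b 0) => // t _.
by rewrite !fctE kN addr0.
Qed.

Lemma LsymM k (t : R) :
  Lsym alpha k * (@real_complex_def _ (Phant R) t) = Complex 0 (freq alpha k * t).
Proof. by rewrite LsymE; apply: complex_eq; rewrite ?Re_mul ?Im_mul/=; ring. Qed.

Lemma cdiff_expL a b (s : R) f f1 : cdiff a b f f1 ->
  cdiff a b (fun t => expL alpha (s * t) (f t))
    (fun t => expL alpha (s * t) (f1 t + Complex s 0 *: Lop alpha (f t))).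
Proof.
move=> df k.
have := has_cderivM (@has_cderiv_cexp _ a b (freq alpha k * s)) (df k).
apply: eq_has_cderiv => [t|t _]; rewrite /expL LsymM mulrA//.
rewrite !fctE /Lop LsymE /GRing.scale/=.
have -> : Complex 0 (freq alpha k * s) = Complex s 0 * Complex 0 (freq alpha k).
  by apply: complex_eq; rewrite ?Re_mul ?Im_mul/=; ring.
by ring.
Qed.

Lemma expLK t (c : coefs) : expL alpha (- t) (expL alpha t c) = c.
Proof.
apply/funext => k; rewrite /expL !LsymM mulrA !cexp_imag mulrN cosN sinN.
rewrite -[RHS]mul1r; congr (_ * _).
have := cos2Dsin2 (freq alpha k * t); rewrite !expr2 => h.
by apply: complex_eq; rewrite ?Re_mul ?Im_mul/=; [rewrite -h|]; ring.
Qed.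

(** A time derivative of a solution costs one grade: [j] counts the derivatives,
    and [i] is the grade in which the last of them is still bounded. *)
Fixpoint smooth a b j i K f : Prop :=
  (forall t, t \in `[a, b] -> nrm (i + j) (f t) <= K) /\
  (if j is j'.+1 then exists2 f1, cdiff a b f f1 & smooth a b j' i K f1
   else True).

Lemma smooth_bound a b j i K f : smooth a b j i K f ->
  forall t, t \in `[a, b] -> nrm (i + j) (f t) <= K.
Proof. by case: j => [|j] []. Qed.

Lemma smooth_le a b j i K K' f : K <= K' ->
  smooth a b j i K f -> smooth a b j i K' f.
Proof.
move=> KK; elim: j f => [|j IH] f /= [bf].
  by move=> _; split=> // t /bf /le_trans; exact.
move=> [f1 df sf]; split=> [t /bf /le_trans|]; first exact.
by exists f1 => //; exact: IH.
Qed.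

Lemma smooth_weaken a b j i K f : smooth a b j i.+1 K f -> smooth a b j i K f.
Proof.
elim: j f => [|j IH] f /= [bf].
  by move=> _; split=> // t /bf; apply: le_trans; rewrite addSn; exact: wnormS.
move=> [f1 df sf]; split; last by exists f1 => //; exact: IH.
by move=> t /bf; apply: le_trans; rewrite addSn; exact: wnormS.
Qed.

Lemma smooth_pred a b j i K f : smooth a b j.+1 i K f -> smooth a b j i.+1 K f.
Proof.
elim: j f => [|j IH] f [bf [f1 df sf]].
  by split=> // t /bf; rewrite addn1 addn0.
split; first by move=> t /bf; rewrite addSnnS.
by exists f1 => //; exact: IH.
Qed.

Lemma smoothD a b j i K K' f g : smooth a b j i K f -> smooth a b j i K' g ->
  smooth a b j i (K + K') (fun t => f t + g t).
Proof.
elim: j f g => [|j IH] f g /= [bf sf] [bg sg]; (split;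
  first by move=> t tab; apply: le_trans (wnormD _ _ _ _ _) _;
    apply: lerD; [exact: bf|exact: bg]) => //.
move: sf sg => [f1 df sf] [g1 dg sg].
by exists (fun t => f1 t + g1 t); [exact: cdiffD|exact: IH].
Qed.

Lemma smoothZ a b j i K (r : R) f : smooth a b j i K f ->
  smooth a b j i (`|r| * K) (fun t => Complex r 0 *: f t).
Proof.
elim: j f => [|j IH] f /= [bf sf]; (split;
  first by move=> t tab; rewrite wnormZ; apply: ler_wpM2l => //; exact: bf) => //.
move: sf => [f1 df sf].
by exists (fun t => Complex r 0 *: f1 t); [exact: cdiffZ|exact: IH].
Qed.

Lemma smooth_Lop a b j i K f : smooth a b j i.+1 K f ->
  smooth a b j i K (fun t => Lop alpha (f t)).
Proof.
elim: j f => [|j IH] f /= [bf sf]; (split;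
  first by move=> t tab; apply: le_trans (wnorm_Lop _ alpha0 _ _) _;
    rewrite -addSn; exact: bf) => //.
move: sf => [f1 df sf].
by exists (fun t => Lop alpha (f1 t)); [exact: cdiff_Lop|exact: IH].
Qed.

Lemma smooth_bil a b j i K K' f g : 0 <= K -> 0 <= K' ->
  smooth a b j i.+1 K f -> smooth a b j i.+1 K' g ->
  smooth a b j i (2 ^+ j * (K * K')) (fun t => B (f t) (g t)).
Proof.
move=> K0 K'0.
have bd l u v : smooth a b l i.+1 K u -> smooth a b l i.+1 K' v ->
    forall t, t \in `[a, b] -> nrm (i + l) (B (u t) (v t)) <= K * K'.
  move=> su sv t tab; apply: le_trans (wnorm_bil _ alpha0 _ _ _) _.
  rewrite -addSn; apply: ler_pM; rewrite ?wnorm_ge0//.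
    exact: (smooth_bound su).
  exact: (smooth_bound sv).
elim: j f g => [|j IH] f g sf sg.
  by split=> // t tab; rewrite mul1r; exact: bd tab.
split=> [t tab|].
  apply: le_trans (bd _ _ _ sf sg _ tab) _.
  by rewrite ler_peMl ?mulr_ge0// exprn_ege1// ler1n.
have [_ [f1 df sf1]] := sf; have [_ [g1 dg sg1]] := sg.
exists (fun t => B (f1 t) (g t) + B (f t) (g1 t)); first exact: cdiff_bil.
have -> : 2 ^+ j.+1 * (K * K') = 2 ^+ j * (K * K') + 2 ^+ j * (K * K').
  by rewrite exprS; ring.
by apply: smoothD; apply: IH => //; apply: smooth_weaken; exact: smooth_pred.
Qed.

Lemma smooth_expL a b j i K (s : R) f : 0 <= K -> `|s| <= 1 ->
  smooth a b j i K f ->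
  smooth a b j i (2 ^+ j * K) (fun t => expL alpha (s * t) (f t)).
Proof.
move=> + s1; elim: j K f => [|j IH] K f K0 sf.
  split=> // t tab; rewrite mul1r wnorm_expL; exact: (smooth_bound sf).
split=> [t tab|].
  rewrite wnorm_expL; apply: le_trans (smooth_bound sf tab) _.
  by rewrite ler_peMl// exprn_ege1// ler1n.
have [_ [f1 df sf1]] := sf.
exists (fun t => expL alpha (s * t) (f1 t + Complex s 0 *: Lop alpha (f t))).
  exact: cdiff_expL.
have -> : 2 ^+ j.+1 * K = 2 ^+ j * (K + K) by rewrite exprSr; ring.
apply: IH; first exact: addr_ge0.
apply: smoothD => //; apply: (@smooth_le _ _ _ _ (`|s| * K)).
  by rewrite ler_piMl.
by apply: smoothZ; apply: smooth_Lop; exact: smooth_pred.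
Qed.

Fixpoint deriv_bound K j : R :=
  if j is j'.+1 then K + deriv_bound K j' + 2 ^+ j' * (deriv_bound K j' * deriv_bound K j') else K.

Lemma deriv_bound_ge0 K j : 0 <= K -> 0 <= deriv_bound K j.
Proof.
by move=> K0; elim: j => [|j IH] //=; rewrite !addr_ge0 ?mulr_ge0 ?exprn_ge0.
Qed.

(** Bootstrap: the equation expresses the time derivative through terms that
    have as many derivatives, one grade lower. *)
Lemma smooth_galerkin a b K f : 0 <= K ->
  cdiff a b f (fun t => Lop alpha (f t) + B (f t) (f t)) ->
  (forall t, t \in `[a, b] -> nrm 5 (f t) <= K) ->
  forall j i, (i + j = 5)%N -> smooth a b j i (deriv_bound K j) f.
Proof.
move=> K0 df bf; elim=> [|j IH] i ij; first by split=> // t tab; rewrite ij; exact: bf.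
have P0 := deriv_bound_ge0 j K0.
have sf : smooth a b j i.+1 (deriv_bound K j) f by apply: IH; rewrite addSnnS.
split=> [t tab|].
  by rewrite ij; apply: le_trans (bf _ tab) _; rewrite /= -addrA lerDl
    addr_ge0 ?mulr_ge0 ?exprn_ge0.
exists (fun t => Lop alpha (f t) + B (f t) (f t)) => //=.
apply: (@smooth_le _ _ _ _ (deriv_bound K j + 2 ^+ j * (deriv_bound K j * deriv_bound K j))).
  by rewrite -addrA lerDr.
by apply: smoothD; [exact: smooth_Lop|exact: smooth_bil].
Qed.

Lemma smooth_chain a b n i K f : smooth a b n i K f ->
  exists F : nat -> R -> coefs,
  [/\ F 0%N = f, forall l, (l < n)%N -> cdiff a b (F l) (F l.+1) &
      forall l t, (l <= n)%N -> t \in `[a, b] -> nrm (i + (n - l)) (F l t) <= K].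
Proof.
elim: n f => [|n IH] f /= [bf].
  move=> _; exists (fun=> f); split=> // l t; rewrite leqn0 => /eqP ->.
  exact: bf.
move=> [f1 df /IH[F [F0 dF bF]]].
exists (fun l => if l is l'.+1 then F l' else f); split=> //.
  by case=> [_|l]; [rewrite F0|rewrite ltnS; exact: dF].
by case=> [|l] t; [rewrite subn0 => _; exact: bf|rewrite ltnS subSS; exact: bF].
Qed.

(** ** Taylor remainders *)

Definition taylor_rem (F : nat -> R -> coefs) a l n t : coefs :=
  F l t - \sum_(m < n) Complex ((t - a) ^+ m / m`!%:R) 0 *: F (l + m)%N a.

Lemma cdiff_taylor_rem a b F l n : (forall m, (m <= n)%N -> cdiff a b (F (l + m)%N) (F (l + m).+1)) ->
  cdiff a b (taylor_rem F a l n.+1) (taylor_rem F a l.+1 n).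
Proof.
move=> dF k.
have dpoly m : has_cderiv a b
    (fun t => Complex ((t - a) ^+ m.+1 / m.+1`!%:R) 0)
    (fun t => Complex ((t - a) ^+ m / m`!%:R) 0).
  apply: has_cderiv_real => t.
  have d1 : is_derive t 1 (fun s : R => s - a) 1.
    by apply: is_derive_eq; rewrite subr0.
  have d := is_deriveZ (m.+1`!%:R^-1 : R) (is_deriveX m.+1 d1).
  have E : (fun s : R => (s - a) ^+ m.+1 / m.+1`!%:R) =
      m.+1`!%:R^-1 *: (fun s : R => s - a) ^+ m.+1.
    by apply/funext => s; rewrite !fctE /GRing.scale/= mulrC.
  rewrite E; refine (is_derive_eq d _).
  rewrite /GRing.scale/= mulr1 factS natrM.
  by field; rewrite !pnatr_eq0 -lt0n fact_gt0/=.
have dS := has_cderiv_sum (index_enum 'I_n) (P := xpredT) (fun (m : 'I_n) _ =>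
  has_cderivM (dpoly m) (has_cderiv_cst a b (F (l + m.+1)%N a k))).
have d0 := dF 0%N (leq0n n) k; rewrite addn0 in d0.
have := has_cderivD d0 (has_cderivD
  (has_cderiv_cst a b (- F l a k)) (has_cderivMl (-1) dS)).
apply: eq_has_cderiv => [t|t _].
  rewrite /taylor_rem big_ord_recl expr0 fact0 divr1 addn0 !fctE.
  rewrite opprD addrA -addrA; congr (_ + _); congr (_ + _).
    rewrite /GRing.scale/=; have -> : Complex (1 : R) 0 = 1 by [].
    by rewrite mul1r.
  rewrite mulN1r; congr (- _); rewrite fct_sumE.
  by apply: eq_bigr => m _; rewrite !fctE lift0.
rewrite /taylor_rem !fctE add0r mulN1r; congr (_ - _).
rewrite fct_sumE; apply: eq_bigr => m _.
by rewrite mulr0 addr0 !fctE addnS addSn.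
Qed.

Lemma wnorm_taylor_rem a b F n l i K : a <= b ->
  (forall m, (m < n)%N -> cdiff a b (F (l + m)%N) (F (l + m).+1)) ->
  (forall t, t \in `[a, b] -> nrm i (F (l + n)%N t) <= K) ->
  forall t, t \in `[a, b] -> nrm i (taylor_rem F a l n t) <= K * (b - a) ^+ n.
Proof.
move=> ab; elim: n l => [|n IH] l dF bF t tab.
  rewrite /taylor_rem big_ord0 subr0 mulr1.
  by have := bF _ tab; rewrite addn0.
have d : cdiff a b (taylor_rem F a l n.+1) (taylor_rem F a l.+1 n).
  exact: cdiff_taylor_rem.
have bd s : s \in `[a, b] ->
    nrm i (taylor_rem F a l.+1 n s) <= K * (b - a) ^+ n.
  apply: IH => [m mn|s']; first by rewrite addSnnS; exact: dF.
  by rewrite addSnnS; exact: bF.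
have aab : a \in `[a, b] by rewrite in_itv/= lexx ab.
have K0 : 0 <= K by apply: le_trans (bF _ aab); exact: wnorm_ge0.
have r0 : taylor_rem F a l n.+1 a = 0.
  rewrite /taylor_rem big_ord_recl big1 => [|m _].
    rewrite addr0 expr0 fact0 divr1 addn0.
    by have -> : Complex (1 : R) 0 = 1 by []; rewrite scale1r subrr.
  rewrite subrr expr0n mul0r; have -> : Complex (0 : R) 0 = 0 by [].
  by rewrite scale0r.
move: tab; rewrite in_itv/= => /andP[at_ tb].
have := cdiff_mvt d bd (lexx a) at_ tb; rewrite r0 subr0 => /le_trans; apply.
rewrite exprSr mulrA; apply: ler_wpM2l; last by rewrite lerB.
by rewrite mulr_ge0 ?exprn_ge0 ?subr_ge0.
Qed.

End TimeRegularity.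

(** * Quadrature of the exact solution *)

Section QuadratureErrors.
Context {R : realType}.
Local Notation C := (complex R).
Local Notation Re := (@complex.Re R).
Local Notation Im := (@complex.Im R).
Local Notation coefs := (@coefs R).
Local Notation "r %* c" := (Complex (r : R) 0 *: (c : coefs)) (at level 40).
Variables (alpha : R) (N : nat).
Hypothesis alpha0 : 0 < alpha.
Local Notation nrm := (wnorm alpha N).
Local Notation B := (bil N).
Implicit Types (c d e : coefs) (i j : nat).

Lemma Re_scale (r : R) (z : C) : Re (Complex r 0 *: z) = r * Re z.
Proof. by rewrite Re_mul/= mul0r subr0. Qed.

Lemma Im_scale (r : R) (z : C) : Im (Complex r 0 *: z) = r * Im z.
Proof. by rewrite Im_mul/= mul0r addr0. Qed.

Lemma Re_opp (z : C) : Re (- z) = - Re z. Proof. by case: z. Qed.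

Lemma Im_opp (z : C) : Im (- z) = - Im z. Proof. by case: z. Qed.

Lemma coefs_eqP c d :
  (forall k, Re (c k) = Re (d k)) -> (forall k, Im (c k) = Im (d k)) -> c = d.
Proof. by move=> h1 h2; apply/funext => k; exact: complex_eq. Qed.

Let ReE := (@Re_add R, Re_opp, Re_scale).
Let ImE := (@Im_add R, Im_opp, Im_scale).

Lemma wnorm_leD i c d (x y : R) : nrm i c <= x -> nrm i d <= y ->
  nrm i (c + d) <= x + y.
Proof. by move=> cx dy; apply: le_trans (wnormD _ _ _ _ _) (lerD cx dy). Qed.

Lemma wnorm_leB i c d (x y : R) : nrm i c <= x -> nrm i d <= y ->
  nrm i (c - d) <= x + y.
Proof. by move=> cx dy; apply: le_trans (wnormB _ _ _ _ _) (lerD cx dy). Qed.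

Lemma wnorm_leZ i c (r x : R) : 0 <= r -> nrm i c <= x -> nrm i (r %* c) <= r * x.
Proof. by move=> r0 cx; rewrite wnormZ ger0_norm//; exact: ler_wpM2l. Qed.

Lemma Re_taylor_rem F (a : R) l n t k : Re (taylor_rem F a l n t k) =
  Re (F l t k) - \sum_(m < n) (t - a) ^+ m / m`!%:R * Re (F (l + m)%N a k).
Proof.
rewrite /taylor_rem !fctE fct_sumE !ReE Re_sum; congr (_ - _).
by apply: eq_bigr => m _; rewrite !fctE !ReE.
Qed.

Lemma Im_taylor_rem F (a : R) l n t k : Im (taylor_rem F a l n t k) =
  Im (F l t k) - \sum_(m < n) (t - a) ^+ m / m`!%:R * Im (F (l + m)%N a k).
Proof.
rewrite /taylor_rem !fctE fct_sumE !ImE Im_sum; congr (_ - _).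
by apply: eq_bigr => m _; rewrite !fctE !ImE.
Qed.

Section Quadrature.
Variables (a h K : R) (F : nat -> R -> coefs).
Hypothesis h0 : 0 < h.
Hypothesis dF : forall l, (l < 5)%N -> cdiff a (a + h) (F l) (F l.+1).
Hypothesis bF : forall l t, (l <= 5)%N -> t \in `[a, a + h] ->
  nrm (5 - l) (F l t) <= K.
Local Notation mid := (a + h / 2).
Local Notation rem := (taylor_rem F a).

Let rem_le l n t : (l + n <= 5)%N -> t \in `[a, a + h] ->
  nrm (5 - (l + n)) (rem l n t) <= K * h ^+ n.
Proof.
move=> ln tab; have e : h = a + h - a by ring.
rewrite [X in K * X ^+ n]e.
apply: wnorm_taylor_rem => // [|m mn|s]; first by rewrite lerDl ltW.
  by apply: dF; apply: leq_trans ln; rewrite ltn_add2l.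

exact: bF.
Qed.

Let mid_in : mid \in `[a, a + h].
Proof. by rewrite in_itv/=; apply/andP; split; have := h0; lra. Qed.

Let end_in : a + h \in `[a, a + h].
Proof. by rewrite in_itv/=; apply/andP; split; have := h0; lra. Qed.

Let end_sub : a + h - a = h. Proof. by ring. Qed.
Let mid_sub : mid - a = h / 2. Proof. by ring. Qed.

(* Expresses an identity between combinations of values and remainders through
   the derivatives at the left end point. *)
Local Ltac taylor_identity := apply: coefs_eqP => k; rewrite !fctE;
  [rewrite !(@Re_taylor_rem, ReE)|rewrite !(@Im_taylor_rem, ImE)];
  rewrite !big_ord_recl !big_ord0 ?lift0 /= ?end_sub ?mid_sub ?factS ?fact0;
  rewrite ?add0n ?addn0 ?add1n /=; field.

Let hh0 : 0 <= h. Proof. exact: ltW. Qed.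
Let h2_0 : 0 <= h / 2. Proof. by rewrite divr_ge0. Qed.
Let h6_0 : 0 <= h / 6. Proof. by rewrite divr_ge0. Qed.

Let rem_at i l n t : (5 - (l + n))%N = i -> t \in `[a, a + h] ->
  (l + n <= 5)%N -> nrm i (rem l n t) <= K * h ^+ n.
Proof. by move=> <- tab ln; exact: rem_le. Qed.

Let eq_le_rem (x y : R) : x = y -> x <= y. Proof. by move=> ->. Qed.

Let K0 : 0 <= K.
Proof. by apply: le_trans (bF (leq0n 5) end_in); exact: wnorm_ge0. Qed.

Let Kh0 n : 0 <= K * h ^+ n. Proof. by rewrite mulr_ge0 ?exprn_ge0. Qed.

Lemma simpson_le :
  nrm 0 (F 0%N (a + h) - F 0%N a -
    (h / 6) %* (F 1%N a + 4 %* F 1%N mid + F 1%N (a + h))) <= 2 * K * h ^+ 5.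
Proof.
have -> : F 0%N (a + h) - F 0%N a -
    (h / 6) %* (F 1%N a + 4 %* F 1%N mid + F 1%N (a + h)) =
  rem 0 5 (a + h) - (h / 6) %* (4 %* rem 1 4 mid + rem 1 4 (a + h)).
  by taylor_identity.
have r1 := @rem_at 0 0 5 _ erefl end_in erefl; have r2 := @rem_at 0 1 4 _ erefl mid_in erefl.
have r3 := @rem_at 0 1 4 _ erefl end_in erefl.
apply: le_trans (wnorm_leB r1 (wnorm_leZ h6_0 (wnorm_leD (wnorm_leZ _ r2) r3))) _ => //.
by have := Kh0 5; rewrite [h ^+ 5]exprS; lra.
Qed.

Lemma quadrature4_le :
  nrm 1 (5 %* F 0%N a - 4 %* F 0%N mid - F 0%N (a + h) + h %* F 1%N a +
    (2 * h) %* F 1%N mid) <= 7 * K * h ^+ 4.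
Proof.
have -> : 5 %* F 0%N a - 4 %* F 0%N mid - F 0%N (a + h) + h %* F 1%N a +
    (2 * h) %* F 1%N mid =
    (2 * h) %* rem 1 3 mid - (4 %* rem 0 4 mid + rem 0 4 (a + h)).
  by taylor_identity.
have r1 := @rem_at 1 1 3 _ erefl mid_in erefl; have r2 := @rem_at 1 0 4 _ erefl mid_in erefl.
have r3 := @rem_at 1 0 4 _ erefl end_in erefl.
apply: le_trans (wnorm_leB (wnorm_leZ _ r1) (wnorm_leD (wnorm_leZ _ r2) r3)) _ => //.
  exact: mulr_ge0.
by apply: eq_le_rem; ring.
Qed.

Lemma trapezoid_le :
  nrm 2 (2 %* F 0%N a + (h / 2) %* (F 1%N a + F 1%N mid) - 2 %* F 0%N mid) <=
  3 * K * h ^+ 3.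
Proof.
have -> : 2 %* F 0%N a + (h / 2) %* (F 1%N a + F 1%N mid) - 2 %* F 0%N mid =
    (h / 2) %* rem 1 2 mid - 2 %* rem 0 3 mid.
  by taylor_identity.
have r1 := @rem_at 2 1 2 _ erefl mid_in erefl; have r2 := @rem_at 2 0 3 _ erefl mid_in erefl.
apply: le_trans (wnorm_leB (wnorm_leZ _ r1) (wnorm_leZ _ r2)) _ => //.
by have := Kh0 3; rewrite [h ^+ 3]exprS; lra.
Qed.

Lemma midpoint_le :
  nrm 2 (F 0%N a + h %* F 1%N mid - F 0%N (a + h)) <= 2 * K * h ^+ 3.
Proof.
have -> : F 0%N a + h %* F 1%N mid - F 0%N (a + h) =
    h %* rem 1 2 mid - rem 0 3 (a + h).
  by taylor_identity.
have r1 := @rem_at 2 1 2 _ erefl mid_in erefl; have r2 := @rem_at 2 0 3 _ erefl end_in erefl.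
apply: le_trans (wnorm_leB (wnorm_leZ _ r1) r2) _ => //.
by apply: eq_le_rem; ring.
Qed.

Lemma euler_le :
  nrm 3 (F 0%N a + (h / 2) %* F 1%N a - F 0%N mid) <= K * h ^+ 2.
Proof.
have -> : F 0%N a + (h / 2) %* F 1%N a - F 0%N mid = - rem 0 2 mid.
  by taylor_identity.
by rewrite wnormN; exact: (@rem_at 3 0 2 _ erefl mid_in erefl).
Qed.

Lemma backward_euler_le :
  nrm 3 (F 0%N a + (h / 2) %* F 1%N mid - F 0%N mid) <= 2 * K * h ^+ 2.
Proof.
have -> : F 0%N a + (h / 2) %* F 1%N mid - F 0%N mid =
    (h / 2) %* rem 1 1 mid - rem 0 2 mid.
  by taylor_identity.
have r1 := @rem_at 3 1 1 _ erefl mid_in erefl; have r2 := @rem_at 3 0 2 _ erefl mid_in erefl.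
apply: le_trans (wnorm_leB (wnorm_leZ _ r1) r2) _ => //.
by have := Kh0 2; rewrite [h ^+ 2]exprS; lra.
Qed.

Lemma half_step_le : nrm 4 (F 0%N (a + h) - F 0%N mid) <= 2 * K * h.
Proof.
have -> : F 0%N (a + h) - F 0%N mid = rem 0 1 (a + h) - rem 0 1 mid.
  by taylor_identity.
have r1 := @rem_at 4 0 1 _ erefl end_in erefl; have r2 := @rem_at 4 0 1 _ erefl mid_in erefl.
apply: le_trans (wnorm_leB r1 r2) _.
by apply: eq_le_rem; ring.
Qed.

End Quadrature.
End QuadratureErrors.

(** * Stage errors of the Runge-Kutta method *)

Section StageErrors.
Context {R : realType}.
Local Notation C := (complex R).
Local Notation Re := (@complex.Re R).
Local Notation Im := (@complex.Im R).
Local Notation coefs := (@coefs R).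
Local Notation "r %* c" := (Complex (r : R) 0 *: (c : coefs)) (at level 40).
Variables (alpha : R) (N : nat).
Hypothesis alpha0 : 0 < alpha.
Local Notation nrm := (wnorm alpha N).
Local Notation B := (bil N).
Implicit Types (c d e : coefs) (i j : nat) (s t : R).

Let ReE := (@Re_add R, @Re_opp R, @Re_scale R).
Let ImE := (@Im_add R, @Im_opp R, @Im_scale R).

Lemma expLD t c d : expL alpha t (c + d) = expL alpha t c + expL alpha t d.
Proof. by apply/funext => k; rewrite /expL !fctE mulrDr. Qed.

Lemma expLN t c : expL alpha t (- c) = - expL alpha t c.
Proof. by apply/funext => k; rewrite /expL !fctE mulrN. Qed.

Lemma expLB t c d : expL alpha t (c - d) = expL alpha t c - expL alpha t d.
Proof. by rewrite expLD expLN. Qed.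

Lemma bilDl c d e : B (c + d) e = B c e + B d e.
Proof.
apply/funext => k; rewrite /bil !fctE; case: ifP => _; last by rewrite addr0.
rewrite -mulrDr /conv -big_split; congr (_ * _); apply: eq_bigr => p _.
by rewrite mulrDl.
Qed.

Lemma bilNl c e : B (- c) e = - B c e.
Proof.
apply/funext => k; rewrite /bil !fctE; case: ifP => _; last by rewrite oppr0.
rewrite -mulrN /conv -sumrN; congr (_ * _); apply: eq_bigr => p _.
by rewrite mulNr.
Qed.

(** The nonlinearity seen in the frame that moves with the linear flow,
    polarized into a symmetric bilinear map. *)
Definition tbil t c d : coefs :=
  expL alpha (- t) (B (expL alpha t c) (expL alpha t d)).

Lemma tbilC t c d : tbil t c d = tbil t d c.
Proof. by rewrite /tbil bilC. Qed.

Lemma tbilDl t c d e : tbil t (c + d) e = tbil t c e + tbil t d e.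
Proof. by rewrite /tbil expLD bilDl expLD. Qed.

Lemma tbilDr t c d e : tbil t e (c + d) = tbil t e c + tbil t e d.
Proof. by rewrite tbilC tbilDl !(tbilC t e). Qed.

Lemma tbilBl t c d e : tbil t (c - d) e = tbil t c e - tbil t d e.
Proof. by rewrite /tbil expLB bilDl bilNl expLB. Qed.

Lemma tbilBr t c d e : tbil t e (c - d) = tbil t e c - tbil t e d.
Proof. by rewrite tbilC tbilBl !(tbilC t e). Qed.

Lemma wnorm_tbil i t c d (x y : R) : nrm i.+1 c <= x -> nrm i.+1 d <= y ->
  nrm i (tbil t c d) <= x * y.
Proof.
move=> cx dy; rewrite wnorm_expL; apply: le_trans (wnorm_bil _ alpha0 _ _ _) _.
by rewrite !wnorm_expL; apply: ler_pM; rewrite ?wnorm_ge0.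
Qed.

Lemma wnorm_expLB i s t c : s <= t ->
  nrm i (expL alpha t c - expL alpha s c) <= (t - s) * nrm i.+1 c.
Proof.
move=> st.
have d : cdiff s t (fun r => expL alpha (1 * r) c)
    (fun r => expL alpha (1 * r) (0 + 1 %* Lop alpha c)).
  by apply: cdiff_expL => k; exact: has_cderiv_cst.
have bd r : r \in `[s, t] ->
    nrm i (expL alpha (1 * r) (0 + 1 %* Lop alpha c)) <= nrm i.+1 c.
  move=> _; rewrite wnorm_expL add0r wnormZ normr1 mul1r.
  exact: wnorm_Lop.
have := cdiff_mvt d bd (lexx s) st (lexx t).
by rewrite !mul1r mulrC.
Qed.

(** Moving the frame by [t - s] costs two grades: one for the generator of the
    flow, one for the nonlinearity. *)
Lemma wnorm_tbil_frame i s t c d (x y : R) : s <= t ->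
  nrm i.+2 c <= x -> nrm i.+2 d <= y ->
  nrm i (tbil t c d - tbil s c d) <= 3 * (t - s) * (x * y).
Proof.
move=> st cx dy.
have x0 : 0 <= x := le_trans (wnorm_ge0 _ _ _ _) cx.
have y0 : 0 <= y := le_trans (wnorm_ge0 _ _ _ _) dy.
have ts0 : 0 <= t - s by rewrite subr_ge0.
pose Et := expL alpha t; pose Es := expL alpha s.
have -> : tbil t c d - tbil s c d =
    - (expL alpha (- s) (B (Et c) (Et d)) - expL alpha (- t) (B (Et c) (Et d))) +
    expL alpha (- s) (B (Et c - Es c) (Et d) + B (Et d - Es d) (Es c)).
  rewrite /tbil -/Et -/Es expLD !bilDl !bilNl !expLD !expLN.
  rewrite (bilC N (Et d) (Es c)) (bilC N (Es d) (Es c)).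
  by apply: coefs_eqP => k; rewrite !fctE ?ReE ?ImE; ring.
have n1 c' x' : nrm i.+2 c' <= x' -> nrm i.+1 (Et c' - Es c') <= (t - s) * x'.
  move=> h; apply: le_trans (wnorm_expLB _ _ st) _.
  exact: ler_wpM2l.
have n2 c' x' : nrm i.+2 c' <= x' -> nrm i.+1 c' <= x'.
  by apply: le_trans; exact: wnormS.
have -> : 3 * (t - s) * (x * y) =
    (t - s) * (x * y) + ((t - s) * x * y + (t - s) * y * x) by ring.
apply: wnorm_leD; last first.
  rewrite wnorm_expL; apply: wnorm_leD.
    apply: le_trans (wnorm_bil _ alpha0 _ _ _) _.
    by apply: ler_pM; rewrite ?wnorm_ge0// ?wnorm_expL; [exact: n1|exact: n2].
  apply: le_trans (wnorm_bil _ alpha0 _ _ _) _.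
  by apply: ler_pM; rewrite ?wnorm_ge0// ?wnorm_expL; [exact: n1|exact: n2].
rewrite wnormN; apply: le_trans (wnorm_expLB _ _ _) _; first by rewrite lerN2.
rewrite opprK addrC; apply: ler_wpM2l => //.
apply: le_trans (wnorm_bil _ alpha0 _ _ _) _.
by rewrite !wnorm_expL; apply: ler_pM; rewrite ?wnorm_ge0.
Qed.

Lemma tbil_sqr t c e : tbil t (c + e) (c + e) =
  tbil t c c + 2 %* tbil t c e + tbil t e e.
Proof.
rewrite tbilDl !tbilDr (tbilC t e c).
by apply: coefs_eqP => k; rewrite !fctE ?ReE ?ImE; ring.
Qed.

(* Linear arithmetic from the premises of the goal alone. *)
Local Ltac lra_in M h := clear -alpha0 N ReE ImE M h; lra.

(** Each stage is compared with the exact solution at its node. The first two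
    stages at the midpoint err by second-order terms that cancel in their sum;
    the remaining third-order terms cancel against the error of the last stage.
    What is left of every first-order variation of the field is then a
    quadrature error of the exact solution. *)
Lemma RK4_error (ts h M : R) (V0 Vh V1 : coefs) :
  let th := ts + h / 2 in
  let te := ts + h in
  let g0 := tbil ts V0 V0 in
  let gh := tbil th Vh Vh in
  let g1 := tbil te V1 V1 in
  0 < h -> h <= 1 -> 1 <= M -> nrm 5 Vh <= M -> nrm 5 V1 <= M ->
  nrm 0 (V1 - V0 - (h / 6) %* (g0 + 4 %* gh + g1)) <= M * h ^+ 5 ->
  nrm 1 (5 %* V0 - 4 %* Vh - V1 + h %* g0 + (2 * h) %* gh) <= M * h ^+ 4 ->
  nrm 2 (2 %* V0 + (h / 2) %* (g0 + gh) - 2 %* Vh) <= M * h ^+ 3 ->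
  nrm 2 (V0 + h %* gh - V1) <= M * h ^+ 3 ->
  nrm 3 (V0 + (h / 2) %* g0 - Vh) <= M * h ^+ 2 ->
  nrm 3 (V0 + (h / 2) %* gh - Vh) <= M * h ^+ 2 ->
  nrm 4 (V1 - Vh) <= M * h ->
  nrm 0 (V1 - RK4 (fun t c => tbil t c c) ts h V0) <= 100 * M ^+ 8 * h ^+ 5.
Proof.
move=> th te g0 gh g1 h0 h1 M1 bVh bV1 simp quad trap mid eul beul half.
have hh0 : 0 <= h := ltW h0.
have M0 : 0 <= M by rewrite (le_trans ler01).
have mono (m n m' n' : nat) : (m <= m')%N -> (n' <= n)%N ->
    M ^+ m * h ^+ n <= M ^+ m' * h ^+ n'.
  move=> lem len; apply: ler_pM; rewrite ?exprn_ge0//.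
    exact: ler_weXn2l.
  exact: ler_wiXn2l.
have pos (m n : nat) : 0 <= M ^+ m * h ^+ n by rewrite mulr_ge0 ?exprn_ge0.
have grade_le i j c x : (i <= j)%N -> nrm j c <= x -> nrm i c <= x.
  by move=> ij; apply: le_trans; exact: wnorm_leq.
have bVh' i : (i <= 5)%N -> nrm i Vh <= M by move=> /grade_le; exact.
have bV1' i : (i <= 5)%N -> nrm i V1 <= M by move=> /grade_le; exact.
have g0E : tbil ts V0 V0 = g0 by []; have ghE : tbil th Vh Vh = gh by [].
have g1E : tbil te V1 V1 = g1 by []; clearbody g0 gh g1.
(* Stage errors: e2, e3, e4, where b and q are the linear and quadratic parts
   of the variation of the field at each stage. *)
have [e2 e2E] : exists e, e = V0 + (h / 2) %* g0 - Vh by eexists.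
have [b2 b2E] : exists b, b = tbil th Vh e2 by eexists.
have [q2 q2E] : exists q, q = tbil th e2 e2 by eexists.
have [e3a e3aE] : exists e, e = V0 + (h / 2) %* gh - Vh by eexists.
have [e3b e3bE] : exists e, e = h %* b2 + (h / 2) %* q2 by eexists.
have [e3 e3E] : exists e, e = e3a + e3b by eexists.
have [q3 q3E] : exists q, q = tbil th e3 e3 by eexists.
have [b3a b3aE] : exists b, b = tbil th Vh e3a by eexists.
have [b3b b3bE] : exists b, b = tbil th Vh e3b by eexists.
have b3E : tbil th Vh e3 = b3a + b3b by rewrite e3E tbilDr b3aE b3bE.
have [e4a e4aE] : exists e, e = (V0 + h %* gh - V1) + (2 * h) %* b3a by eexists.
have [e4b e4bE] : exists e, e = (2 * h) %* b3b + h %* q3 by eexists.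
have [e4 e4E] : exists e, e = e4a + e4b by eexists.
have [b4 b4E] : exists b, b = tbil te V1 e4 by eexists.
have [q4 q4E] : exists q, q = tbil te e4 e4 by eexists.
have [X XE'] : exists X, X = (e2 + e3) + (e2 + e3) + e4 by eexists.
have RKE : RK4 (fun t c => tbil t c c) ts h V0 =
    V0 + (h / 6) %* (g0 + 2 %* (gh + 2 %* b2 + q2) +
      2 %* (gh + 2 %* (b3a + b3b) + q3) + (g1 + 2 %* b4 + q4)).
  rewrite /RK4 -/th -/te g0E.
  have -> : V0 + Complex 2^-1 0 *: (Complex h 0 *: g0) = Vh + e2.
    by rewrite e2E; apply: coefs_eqP => k; rewrite !fctE ?ReE ?ImE; field.
  rewrite tbil_sqr -b2E -q2E ghE.
  have -> : V0 + Complex 2^-1 0 *: (Complex h 0 *: (gh + 2 %* b2 + q2)) = Vh + e3.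
    rewrite e3E e3aE e3bE.
    by apply: coefs_eqP => k; rewrite !fctE ?ReE ?ImE; field.
  rewrite tbil_sqr b3E -q3E ghE.
  have -> : V0 + Complex h 0 *: (gh + 2 %* (b3a + b3b) + q3) = V1 + e4.
    rewrite e4E e4aE e4bE.
    by apply: coefs_eqP => k; rewrite !fctE ?ReE ?ImE; ring.
  rewrite tbil_sqr -b4E -q4E g1E.
  by apply: coefs_eqP => k; rewrite !mulr2n !fctE ?ReE ?ImE; field.
have XE : X = (5 %* V0 - 4 %* Vh - V1 + h %* g0 + (2 * h) %* gh) +
    ((2 * h) %* tbil th Vh (e2 + e3) + h %* (q2 + q3)).
  rewrite tbilDr -b2E b3E XE' e4E e4aE e4bE e3E e3aE e3bE e2E.
  by apply: coefs_eqP => k; rewrite !fctE ?ReE ?ImE; field.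
have errE : V1 - RK4 (fun t c => tbil t c c) ts h V0 =
    (V1 - V0 - (h / 6) %* (g0 + 4 %* gh + g1)) -
    (h / 6) %* (2 %* tbil th Vh X +
      2 %* (tbil te (V1 - Vh) e4 + (tbil te Vh e4a - tbil th Vh e4a) +
            (tbil te Vh e4b - tbil th Vh e4b)) +
      (2 %* (q2 + q3) + q4)).
  rewrite RKE XE' !tbilDr tbilBl -b4E -b2E b3E e4E !tbilDr.
  move: (tbil th Vh e4a) (tbil th Vh e4b) (tbil te Vh e4a) (tbil te Vh e4b).
  move=> x1 x2 x3 x4.
  by apply: coefs_eqP => k; rewrite !fctE ?ReE ?ImE; field.
have n_e2 : nrm 3 e2 <= M * h ^+ 2 by rewrite e2E.
have n_e3a : nrm 3 e3a <= M * h ^+ 2 by rewrite e3aE.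
have n_b2 : nrm 2 b2 <= M * (M * h ^+ 2).
  by rewrite b2E; apply: wnorm_tbil => //; exact: bVh'.
have n_q2 : nrm 2 q2 <= (M * h ^+ 2) * (M * h ^+ 2).
  by rewrite q2E; exact: wnorm_tbil.
have n_e3b : nrm 2 e3b <= 2 * (M ^+ 2 * h ^+ 3).
  rewrite e3bE; apply: le_trans (wnorm_leD (wnorm_leZ hh0 n_b2) (wnorm_leZ _ n_q2)) _.
    by rewrite divr_ge0.
  by have := pos 2%N 3%N; have := mono 2%N 5%N 2%N 3%N isT isT; lra_in M h.
have n_e3 : nrm 2 e3 <= 3 * (M ^+ 2 * h ^+ 2).
  rewrite e3E; apply: le_trans (wnorm_leD (grade_le 2%N 3%N _ _ isT n_e3a) n_e3b) _.
  by have := mono 2%N 3%N 2%N 2%N isT isT;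
    have := mono 1%N 2%N 2%N 2%N isT isT; have := pos 2%N 2%N; lra_in M h.
have n_e23 : nrm 2 (e2 + e3) <= 3 * (M ^+ 2 * h ^+ 3).
  have -> : e2 + e3 = (2 %* V0 + (h / 2) %* (g0 + gh) - 2 %* Vh) + e3b.
    by rewrite e3E e2E e3aE; apply: coefs_eqP => k; rewrite !fctE ?ReE ?ImE; field.
  apply: le_trans (wnorm_leD trap n_e3b) _.
  by have := mono 1%N 3%N 2%N 3%N isT isT; have := pos 2%N 3%N; lra_in M h.
(* Comparing the fields at the middle and at the end of the step costs two
   grades, hence the splitting of e4: only e4a is controlled in grade 2, while
   e4b, controlled in grade 1, is smaller by one power of the step. *)
have n_e4a : nrm 2 e4a <= 3 * (M ^+ 2 * h ^+ 3).
  have t1 : nrm 2 b3a <= M * (M * h ^+ 2).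
    by rewrite b3aE; apply: wnorm_tbil => //; exact: bVh'.
  rewrite e4aE; apply: le_trans (wnorm_leD mid (wnorm_leZ _ t1)) _; first by rewrite mulr_ge0.
  by have := mono 1%N 3%N 2%N 3%N isT isT; have := pos 2%N 3%N; lra_in M h.
have n_q3 : nrm 1 q3 <= 9 * (M ^+ 4 * h ^+ 4).
  by rewrite q3E; apply: le_trans (wnorm_tbil _ n_e3 n_e3) _; lra_in M h.
have n_e4b : nrm 1 e4b <= 13 * (M ^+ 4 * h ^+ 4).
  have t1 : nrm 1 b3b <= M * (2 * (M ^+ 2 * h ^+ 3)).
    by rewrite b3bE; apply: wnorm_tbil => //; exact: bVh'.
  rewrite e4bE; apply: le_trans (wnorm_leD (wnorm_leZ _ t1) (wnorm_leZ hh0 n_q3)) _.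
    by rewrite mulr_ge0.
  by have := mono 3%N 4%N 4%N 4%N isT isT;
    have := mono 4%N 5%N 4%N 4%N isT isT; have := pos 4%N 4%N; lra_in M h.
have n_e4 : nrm 1 e4 <= 16 * (M ^+ 4 * h ^+ 3).
  rewrite e4E; apply: le_trans (wnorm_leD (grade_le 1%N 2%N _ _ isT n_e4a) n_e4b) _.
  by have := mono 2%N 3%N 4%N 3%N isT isT;
    have := mono 4%N 4%N 4%N 3%N isT isT; have := pos 4%N 3%N; lra_in M h.
have n_X : nrm 1 X <= 17 * (M ^+ 4 * h ^+ 4).
  have t1 : nrm 1 (tbil th Vh (e2 + e3)) <= M * (3 * (M ^+ 2 * h ^+ 3)).
    by apply: wnorm_tbil => //; exact: bVh'.
  rewrite XE; apply: le_trans (wnorm_leD quad (wnorm_leD (wnorm_leZ _ t1)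
    (wnorm_leZ hh0 (wnorm_leD (grade_le 1%N 2%N _ _ isT n_q2) n_q3)))) _.
    by rewrite mulr_ge0.
  by have := mono 1%N 4%N 4%N 4%N isT isT;
    have := mono 3%N 4%N 4%N 4%N isT isT;
    have := mono 2%N 5%N 4%N 4%N isT isT;
    have := mono 4%N 5%N 4%N 4%N isT isT; have := pos 4%N 4%N; lra_in M h.
have n_1 : nrm 0 (tbil th Vh X) <= M * (17 * (M ^+ 4 * h ^+ 4)).
  by apply: wnorm_tbil => //; exact: bVh'.
have n_2 : nrm 0 (tbil te (V1 - Vh) e4) <= (M * h) * (16 * (M ^+ 4 * h ^+ 3)).
  by apply: wnorm_tbil => //; exact: grade_le half.
have n_3 : nrm 0 (tbil te Vh e4a - tbil th Vh e4a) <=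
    3 * (te - th) * (M * (3 * (M ^+ 2 * h ^+ 3))).
  by apply: wnorm_tbil_frame => //; [rewrite /te /th; lra|exact: bVh'].
have n_4 t : nrm 0 (tbil t Vh e4b) <= M * (13 * (M ^+ 4 * h ^+ 4)).
  by apply: wnorm_tbil => //; exact: bVh'.
have n_q4 : nrm 0 q4 <= (16 * (M ^+ 4 * h ^+ 3)) * (16 * (M ^+ 4 * h ^+ 3)).
  by rewrite q4E; exact: wnorm_tbil.
have teh : te - th = h / 2 by rewrite /te /th; field.
have h6_0 : 0 <= h / 6 by rewrite divr_ge0.
rewrite errE; apply: le_trans (wnorm_leB simp (wnorm_leZ h6_0 (wnorm_leD
  (wnorm_leD (wnorm_leZ _ n_1) (wnorm_leZ _ (wnorm_leD (wnorm_leD n_2 n_3)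
    (wnorm_leB (n_4 te) (n_4 th)))))
  (wnorm_leD (wnorm_leZ _ (wnorm_leD (grade_le 0%N 2%N _ _ isT n_q2)
     (grade_le 0%N 1%N _ _ isT n_q3))) n_q4)))) _ => //.
rewrite teh.
have := mono 1%N 5%N 8%N 5%N isT isT; have := mono 5%N 5%N 8%N 5%N isT isT.
have := mono 3%N 5%N 8%N 5%N isT isT; have := mono 2%N 5%N 8%N 5%N isT isT.
have := mono 4%N 5%N 8%N 5%N isT isT; have := mono 8%N 7%N 8%N 5%N isT isT.
by have := pos 8%N 5%N; lra_in M h.
Qed.

End StageErrors.

(** * Solutions of the Galerkin and of the transformed system *)

Section Flows.
Context {R : realType}.
Local Notation C := (complex R).
Local Notation Re := (@complex.Re R).
Local Notation Im := (@complex.Im R).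
Local Notation nc := Normc.normc.
Local Notation coefs := (@coefs R).
Local Notation "r %* c" := (Complex (r : R) 0 *: (c : coefs)) (at level 40).
Variables (alpha : R) (N : nat).
Hypothesis alpha0 : 0 < alpha.
Local Notation nrm := (wnorm alpha N).
Local Notation B := (bil N).
Implicit Types (c d e : coefs) (i j : nat) (s t : R).

Let ReE := (@Re_add R, @Re_opp R, @Re_scale R).
Let ImE := (@Im_add R, @Im_opp R, @Im_scale R).

Lemma XN_expL t c : XN N c -> XN N (expL alpha t c).
Proof.
move=> /XN_hermitian[c0 cj]; apply/XN_hermitian.
split=> k; first by move=> kN; rewrite /expL c0// mulr0.
rewrite /expL cj conjcM; congr (_ * _).
rewrite !LsymM !cexp_imag; have -> : freq alpha (- k) = - freq alpha k.
  rewrite /freq /sqk /= !rmorphN/= !sqrrN mulNr.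
  by [].
by rewrite mulNr cosN sinN.
Qed.

Lemma transformed_tbil t c : XN N c -> transformed alpha N t c = tbil alpha N t c c.
Proof. by move=> cX; rewrite /transformed Nonlin_bil//; exact: XN_expL. Qed.

Lemma XN_tbil t c : XN N c -> XN N (tbil alpha N t c c).
Proof. by move=> cX; apply/XN_expL/XN_bil; exact: XN_expL. Qed.

Lemma Psi_tbil ts h Z : XN N Z ->
  Psi alpha N ts h Z = RK4 (fun t c => tbil alpha N t c c) ts h Z.
Proof.
move=> ZX; rewrite /Psi /RK4 (transformed_tbil _ ZX).
set K1 := _ *: tbil _ _ _ _ _.
have X1 : XN N (Z + Complex 2^-1 0 *: K1).
  by apply: XND => //; apply: XNZ; apply: XNZ; exact: XN_tbil.
rewrite (transformed_tbil _ X1); set K2 := _ *: tbil _ _ _ _ _.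
have X2 : XN N (Z + Complex 2^-1 0 *: K2).
  by apply: XND => //; apply: XNZ; apply: XNZ; exact: XN_tbil.
rewrite (transformed_tbil _ X2); set K3 := _ *: tbil _ _ _ _ _.
have X3 : XN N (Z + K3).
  by apply: XND => //; apply: XNZ; exact: XN_tbil.
by rewrite (transformed_tbil _ X3).
Qed.

Lemma expLKN t c : expL alpha t (expL alpha (- t) c) = c.
Proof. by rewrite -{1}[t]opprK expLK. Qed.

Lemma Lop_expL t c : Lop alpha (expL alpha t c) = expL alpha t (Lop alpha c).
Proof. by apply/funext => k; rewrite /Lop /expL mulrCA. Qed.

Lemma cdiff_flow a b (S : R -> coefs) :
  is_solution N (transformed alpha N) a b S ->
  cdiff a b S (fun t => tbil alpha N t (S t) (S t)).
Proof.
move=> [SX dS] k; apply: eq_has_cderiv (dS k) => // t tab.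
by rewrite transformed_tbil//; apply: SX; apply: subset_itv_oo_cc tab.
Qed.

Lemma cdiff_galerkin_of_flow a b (S : R -> coefs) :
  is_solution N (transformed alpha N) a b S ->
  let U t := expL alpha t (S t) in
  cdiff a b U (fun t => Lop alpha (U t) + B (U t) (U t)).
Proof.
move=> /cdiff_flow dS U k; apply: eq_has_cderiv (cdiff_expL alpha 1 dS k).
  by move=> t; rewrite mul1r.
move=> t _; rewrite mul1r expLD expLKN Lop_expL addrC.
by have -> : Complex (1 : R) 0 = 1 by []; rewrite scale1r.
Qed.

Lemma flow_of_galerkin a b a' b' (U : R -> coefs) : a <= a' -> b' <= b ->
  is_solution N (galerkin alpha N) a b U ->
  is_solution N (transformed alpha N) a' b' (fun t => expL alpha (- t) (U t)).
Proof.
move=> aa bb [UX dU].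
have sub t : t \in `[a', b'] -> t \in `[a, b].
  by rewrite !in_itv/= => /andP[h1 h2]; rewrite (le_trans aa h1) (le_trans h2 bb).
have dU' : cdiff a' b' U (fun t => galerkin alpha N t (U t)).
  by move=> k; exact: has_cderiv_sub aa bb (dU k).
split=> [t /sub tab|k]; first by apply: XN_expL; exact: UX.
apply: eq_has_cderiv (cdiff_expL alpha (-1) dU' k) => [t|t tab].
  by rewrite mulN1r.
have UtX : XN N (U t) by apply: UX; apply: sub; exact: subset_itv_oo_cc tab.
rewrite mulN1r /transformed expLKN /galerkin; congr expL.
by apply: coefs_eqP => l; rewrite !fctE ?ReE ?ImE; ring.
Qed.

(** ** Uniqueness *)

Lemma has_cderiv_bounded a b (u u1 : R -> C) : a <= b -> has_cderiv a b u u1 ->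
  exists K, forall t, t \in `[a, b] -> nc (u t) <= K.
Proof.
move=> ab [cu cu' _].
have cg : {within `[a, b], continuous (fun t => nc (u t) ^+ 2)}.
  have -> : (fun t => nc (u t) ^+ 2) =
      (fun t => Re (u t) * Re (u t) + Im (u t) * Im (u t)).
    by apply/funext => t; rewrite sqr_normcE !expr2.
  by move=> x; apply: cvgD; apply: cvgM; [exact: cu..|exact: cu'|exact: cu'].
have [c _ cmax] := EVT_max ab cg.
exists (nc (u c)) => t tab; rewrite -(@ler_pXn2r _ 2)// ?nnegrE ?normc_ge0//.
exact: cmax.
Qed.

Lemma cdiff_bounded a b i (f f1 : R -> coefs) : a <= b -> cdiff a b f f1 ->
  exists K, forall t, t \in `[a, b] -> nrm i (f t) <= K.
Proof.
move=> ab df; have [K hK] := choice (fun k => has_cderiv_bounded ab (df k)).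
exists (\sum_(k <- modes N) grade alpha k ^+ i * K k) => t tab.
apply: ler_sum => k _; apply: ler_wpM2l; first by rewrite exprn_ge0 ?grade_ge0.
exact: hK.
Qed.

(** With finitely many modes one grade costs no more than a constant. It depends
    on [N], which is harmless for uniqueness. *)
Lemma wnormS_le i c :
  nrm i.+1 c <= (\sum_(k <- modes N) grade alpha k) * nrm i c.
Proof.
rewrite /wnorm mulr_sumr big_seq [leRHS]big_seq; apply: ler_sum => k kN.
rewrite exprS -mulrA; apply: ler_wpM2r.
  by rewrite mulr_ge0 ?exprn_ge0 ?grade_ge0 ?normc_ge0.
rewrite (bigD1_seq k kN (uniq_modes N))/= lerDl.
by apply: sumr_ge0 => l _; exact: grade_ge0.
Qed.

(** On a time interval of length at most half the inverse of the Lipschitz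
    constant, the supremum of the difference is at most half of itself; such
    intervals are then chained. *)
Lemma linear_gronwall a b L (D D1 : R -> coefs) : a <= b -> 0 < L ->
  cdiff a b D D1 -> D a = 0 ->
  (forall t, t \in `[a, b] -> nrm 0 (D1 t) <= L * nrm 0 (D t)) ->
  forall t, t \in `[a, b] -> nrm 0 (D t) = 0.
Proof.
move=> ab L0 dD Da0 lip.
have [K hK] := cdiff_bounded 0 ab dD.
pose del := (2 * L)^-1.
have del0 : 0 < del by rewrite invr_gt0 mulr_gt0.
have step x : a <= x -> nrm 0 (D x) = 0 ->
    forall t, t \in `[a, b] -> x <= t -> t <= x + del -> nrm 0 (D t) = 0.
  move=> ax Dx0 t; rewrite in_itv/= => /andP[at_ tb] xt txd.
  pose A := [set nrm 0 (D s) | s in `[x, t]].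
  have inab s : s \in `[x, t] -> s \in `[a, b].
    by rewrite !in_itv/= => /andP[h1 h2]; rewrite (le_trans ax h1) (le_trans h2 tb).
  have ubA : ubound A K by move=> _ [s sxt <-]; apply: hK; exact: inab.
  have A0 : A !=set0 by exists (nrm 0 (D t)); exists t => //=; rewrite in_itv/= xt lexx.
  have le_sup s : s \in `[x, t] -> nrm 0 (D s) <= sup A.
    by move=> sxt; apply: ub_le_sup; [exists K|exists s].
  have sup0 : 0 <= sup A.
    by apply: le_trans (le_sup t _); [exact: wnorm_ge0|rewrite in_itv/= xt lexx].
  have bd s : s \in `[x, t] -> nrm 0 (D1 s) <= L * sup A.
    move=> sxt; apply: le_trans (lip _ (inab _ sxt)) _.
    by apply: ler_wpM2l; [exact: ltW|exact: le_sup].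
  have half : sup A <= sup A / 2.
    apply: ge_sup => // _ [s /= sxt <-].
    have /andP[xs st] : x <= s <= t by move: sxt; rewrite in_itv.
    have dDs : cdiff x t D D1 by move=> k; exact: has_cderiv_sub ax tb (dD k).
    have := cdiff_mvt dDs bd (lexx x) xs st.
    have tri : nrm 0 (D s) <= nrm 0 (D s - D x).
      rewrite -[X in nrm 0 X <= _](subrK (D x)).
      by apply: le_trans (wnormD _ _ _ _ _) _; rewrite Dx0 addr0.
    move=> /(le_trans tri) /le_trans; apply.
    apply: (@le_trans _ _ (L * sup A * del)).
      by apply: ler_wpM2l; [rewrite mulr_ge0// ltW|rewrite lerBlDl (le_trans st)].
    rewrite le_eqVlt; apply/orP; left; apply/eqP; rewrite /del; field.
    by rewrite gt_eqF.
  have supE : sup A = 0 by apply/eqP; rewrite eq_le sup0 andbT; lra.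
  apply/eqP; rewrite eq_le wnorm_ge0 andbT -supE; apply: le_sup.
  by rewrite in_itv/= xt lexx.
have chain n t : t \in `[a, b] -> t <= a + n%:R * del -> nrm 0 (D t) = 0.
  elim: n t => [|n IH] t tab tn.
    have -> : t = a.
      apply/eqP; rewrite eq_le; move: tab tn; rewrite in_itv/= mul0r addr0.
      by move=> /andP[-> _] ->.
    by rewrite Da0 /wnorm big1// => k _; rewrite Normc.normc0 mulr0.
  have [tx|xt] := leP t (a + n%:R * del); first exact: IH.
  have ax : a <= a + n%:R * del by rewrite lerDl mulr_ge0// ltW.
  apply: (step _ ax _ _ tab (ltW xt)); last first.
    by move: tn; rewrite -natr1; lra.
  apply: IH => //; move: tab; rewrite !in_itv/= ax => /andP[_ tb].
  exact: le_trans (ltW xt) tb.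
move=> t tab; apply: (chain (Num.bound ((t - a) / del))) => //.
rewrite -lerBlDl -ler_pdivrMr//.
apply: ltW; apply: archi_boundP; rewrite divr_ge0 ?(ltW del0)// subr_ge0.
by move: tab; rewrite in_itv/= => /andP[].
Qed.

Lemma flow_unique a b (S V : R -> coefs) : a <= b ->
  is_solution N (transformed alpha N) a b S ->
  is_solution N (transformed alpha N) a b V -> S a = V a -> S b = V b.
Proof.
move=> ab solS solV SV.
have dS := cdiff_flow solS; have dV := cdiff_flow solV.
pose W t := S t + V t.
have dW := cdiffD dS dV.
have [K hK] := cdiff_bounded 1 ab dW.
pose G := \sum_(k <- modes N) grade alpha k.
have G0 : 0 <= G by apply: sumr_ge0 => k _; exact: grade_ge0.
have K0 : 0 <= K.
  by apply: le_trans (hK a _); [exact: wnorm_ge0|rewrite in_itv/= lexx].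
pose D t := S t + Complex (-1) 0 *: V t.
have dD := cdiffD dS (cdiffZ (-1) dV).
have bab : b \in `[a, b] by rewrite in_itv/= lexx ab.
have D0 : nrm 0 (D b) = 0.
  apply: (@linear_gronwall a b (K * G + 1) D _ ab _ dD) => //.
  - by rewrite ltr_wpDl// mulr_ge0.
  - by rewrite /D SV; apply: coefs_eqP => k; rewrite !fctE ?ReE ?ImE/=; ring.
  move=> t tab.
  have -> : tbil alpha N t (S t) (S t) + Complex (-1) 0 *: tbil alpha N t (V t) (V t) =
      tbil alpha N t (W t) (D t).
    have DE : D t = S t - V t.
      by apply: coefs_eqP => k; rewrite !fctE ?ReE ?ImE/=; ring.
    rewrite DE tbilBr /W !tbilDl (tbilC _ _ t (V t) (S t)).
    by apply: coefs_eqP => k; rewrite !fctE ?ReE ?ImE/=; ring.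
  apply: le_trans (wnorm_tbil alpha0 t (hK _ tab) (wnormS_le 0 (D t))) _.
  rewrite -/G mulrA ler_wpM2r ?wnorm_ge0//.
  by rewrite lerDl.
have := proj1 solS _ bab; have := proj1 solV _ bab.
move=> [Vz _] [Sz _]; apply/funext => k.
have [kN|kN] := boolP (k \in modes N); last by rewrite Vz// Sz.
have := D0 => /eqP; rewrite psumr_eq0; last first.
  by move=> l _; rewrite mulr_ge0 ?exprn_ge0 ?grade_ge0 ?normc_ge0.
move=> /allP/(_ k kN); rewrite mul1r => /eqP/Normc.eq0_normc.
rewrite /D !fctE => Dk; apply: complex_eq.
  by have := congr1 Re Dk; rewrite !ReE/=; lra.
by have := congr1 Im Dk; rewrite !ImE/=; lra.
Qed.

End Flows.

(** * The local truncation error *)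

Section LocalTruncationError.
Context {R : realType}.
Local Notation coefs := (@coefs R).
Variables (alpha q : R).
Hypothesis halpha : 0 < alpha <= 2.
Hypothesis hq : 4 * (1 + alpha) + 5 < q.

Let alpha0 : 0 < alpha. Proof. by case/andP: halpha. Qed.

(** Bound for the first five derivatives of the transformed solution, each in
    its own grade. *)
Definition flow_bound (Rad : R) : R :=
  let K := grade_bound alpha Rad in
  K + 2 ^+ 4 * (2 ^+ 4 * (deriv_bound K 4 * deriv_bound K 4)).

Lemma flow_bound_ge0 Rad : 0 <= flow_bound Rad.
Proof.
have K0 := grade_bound_ge0 alpha Rad.
by rewrite addr_ge0// !mulr_ge0 ?exprn_ge0 ?deriv_bound_ge0.
Qed.

Definition error_const (Rad : R) : R :=
  2 * pi * (100 * (1 + 7 * flow_bound Rad) ^+ 8).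

Lemma error_const_gt0 Rad : 0 < error_const Rad.
Proof.
have M0 : 0 < 1 + 7 * flow_bound Rad.
  by rewrite ltr_pwDl// mulr_ge0// flow_bound_ge0.
by rewrite mulr_gt0 ?mulr_gt0 ?pi_gt0 ?exprn_gt0.
Qed.

Lemma flow_chain N a b (S : R -> coefs) Rad : 0 <= Rad ->
  is_solution N (transformed alpha N) a b S ->
  (supHnorm q N a b (fun t => expL alpha t (S t)) <= Rad%:E)%E ->
  exists F : nat -> R -> coefs,
  [/\ F 0%N = S, F 1%N = (fun t => tbil alpha N t (S t) (S t)),
      forall l, (l < 5)%N -> cdiff a b (F l) (F l.+1) &
      forall l t, (l <= 5)%N -> t \in `[a, b] ->
        wnorm alpha N (5 - l) (F l t) <= flow_bound Rad].
Proof.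
move=> Rad0 solS supS; pose K := grade_bound alpha Rad.
have K0 : 0 <= K by exact: grade_bound_ge0.
pose U t := expL alpha t (S t).
have bU t : t \in `[a, b] -> wnorm alpha N 5 (U t) <= K.
  move=> tab; apply: (wnorm5_le_Hnorm halpha hq) => //.
    by apply: XN_expL; exact: (proj1 solS).
  by apply: le_trans supS; apply: ereal_sup_ubound; exists t.
have dU : cdiff a b U (fun t => Lop alpha (U t) + bil N (U t) (U t)).
  exact: cdiff_galerkin_of_flow.
have sU := smooth_galerkin alpha0 K0 dU bU (erefl 5%N : (1 + 4 = 5)%N).
have P0 := deriv_bound_ge0 4 K0.
have sB := smooth_bil alpha0 P0 P0 sU sU.
have sV : smooth alpha N a b 4 0 (2 ^+ 4 * (2 ^+ 4 * (deriv_bound K 4 * deriv_bound K 4)))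
    (fun t => expL alpha (-1 * t) (bil N (U t) (U t))).
  apply: smooth_expL => //; first by rewrite !mulr_ge0 ?exprn_ge0.
  by rewrite normrN1.
have [F [F0 dF bF]] := smooth_chain sV.
have F0E : F 0%N = (fun t => tbil alpha N t (S t) (S t)).
  by rewrite F0; apply/funext => t; rewrite mulN1r.
exists (fun l => if l is l'.+1 then F l' else S); split=> //.
  by case=> [_|l]; [rewrite F0E; exact: cdiff_flow|exact: dF].
case=> [|l] t l5 tab; last first.
  by apply: le_trans (bF _ _ l5 tab) _; rewrite lerDr.
rewrite subn0 -(wnorm_expL alpha N 5 t); apply: le_trans (bU _ tab) _.
by rewrite lerDl !mulr_ge0 ?exprn_ge0.
Qed.

Lemma local_error (Rad : R) N (ts h : R) (Z : coefs) (S : R -> coefs) :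
  0 < Rad -> 0 < h -> h <= 1 ->
  is_exact_flow alpha N ts (ts + h) Z S ->
  (supHnorm q N ts (ts + h)%R (fun t => expL alpha t (S t)) <= Rad%:E)%E ->
  L2norm (poly_of N (S (ts + h) - Psi alpha N ts h Z)) <=
  error_const Rad * h ^+ 5.
Proof.
move=> Rad0 h0 h1 [solS SZ] supS.
have in0 : ts \in `[ts, ts + h] by rewrite in_itv/=; apply/andP; split; lra.
have inh : ts + h / 2 \in `[ts, ts + h].
  by rewrite in_itv/=; apply/andP; split; lra.
have in1 : ts + h \in `[ts, ts + h].
  by rewrite in_itv/=; apply/andP; split; lra.
have ZX : XN N Z by rewrite -SZ; exact: (proj1 solS).
have [F [F0 F1 dF bF]] := flow_chain (ltW Rad0) solS supS.
pose K := flow_bound Rad; have K0 : 0 <= K := flow_bound_ge0 Rad.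
pose M := 1 + 7 * K.
have KM x y : 0 <= x <= 7 -> 0 <= y -> x * K * y <= M * y.
  by move=> /andP[x0 x7] y0; apply: ler_wpM2r => //; rewrite /M; nra.
have hn n : 0 <= h ^+ n by rewrite exprn_ge0// ltW.
rewrite Psi_tbil// /error_const -mulrA.
apply: le_trans (L2norm_le_wnorm alpha N _) _.
apply: ler_wpM2l; first by rewrite mulr_ge0// pi_ge0.
rewrite -SZ.
have bS t : t \in `[ts, ts + h] -> wnorm alpha N 5 (S t) <= M.
  by move=> tab; apply: le_trans (_ : K <= M); [rewrite -F0; exact: (bF 0%N)|rewrite /M; lra].
have Q1 := simpson_le h0 dF bF; have Q2 := quadrature4_le h0 dF bF.
have Q3 := trapezoid_le h0 dF bF; have Q4 := midpoint_le h0 dF bF.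
have Q5 := euler_le h0 dF bF; have Q6 := backward_euler_le h0 dF bF.
have Q7 := half_step_le h0 dF bF.
rewrite F0 F1 in Q1 Q2 Q3 Q4 Q5 Q6 Q7.
apply: (@RK4_error _ _ _ alpha0 _ _ M _ (S (ts + h / 2))) => //.
- by rewrite /M; lra.
- exact: bS.
- exact: bS.
- by apply: le_trans Q1 _; apply: KM => //; lra.
- by apply: le_trans Q2 _; apply: KM => //; lra.
- by apply: le_trans Q3 _; apply: KM => //; lra.
- by apply: le_trans Q4 _; apply: KM => //; lra.
- by apply: le_trans Q5 _; rewrite -[flow_bound Rad]mul1r; apply: KM => //; lra.
- by apply: le_trans Q6 _; apply: KM => //; lra.
- by apply: le_trans Q7 _; apply: KM => //; [lra|exact: ltW].
Qed.

End LocalTruncationError.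

Theorem theorem5p4 (R : realType) (alpha q : R)
    (halpha : 0 < alpha <= 2) (hq : 4 * (1 + alpha) + 5 < q) :
  forall Rad : R, 0 < Rad ->
  exists2 h0 : R, 0 < h0 &
  forall T : R, 0 < T ->
  exists2 CR : R, 0 < CR &
  (forall (N : nat) (ts : R) (Z : @coefs R) (h : R) (S : R -> @coefs R),
     (1 <= N)%N -> 0 <= ts <= T -> XN N Z -> 0 < h <= T - ts ->
     is_exact_flow alpha N ts (ts + h) Z S ->
     (supHnorm q N ts (ts + h)%R (fun t => expL alpha t (S t)) <= Rad%:E)%E ->
     h <= h0 ->
     L2norm (poly_of N (S (ts + h)%R - Psi alpha N ts h Z)) <= CR * h ^+ 5)
  /\
  (forall (N M n : nat) (u0 : R * R -> R) (U S : R -> @coefs R),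
     let dt := T / M%:R in
     let tn (j : nat) := j%:R * dt in
     let V t := expL alpha (- t) (U t) in
     (1 <= N)%N -> (n < M)%N -> L2 u0 ->
     is_solution N (galerkin alpha N) 0 T U -> U 0 = PiN N u0 ->
     is_exact_flow alpha N (tn n) (tn n.+1) (V (tn n)) S ->
     (supHnorm q N (tn n) (tn n.+1) U <= Rad%:E)%E ->
     dt <= h0 ->
     let tau := S (tn n.+1) - Psi alpha N (tn n) dt (V (tn n)) in
     L2norm (poly_of N tau) <= CR * dt ^+ 5).
Proof.
have alpha0 : 0 < alpha by case/andP: halpha.
(* The bound on the step only serves to absorb higher powers of it. *)
move=> Rad Rad0; exists 1 => // T T0; exists (error_const alpha Rad).
  exact: error_const_gt0.
split=> [N ts Z h S _ _ _ /andP[h0 _] flowS supS h1|].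
  exact: (local_error halpha hq Rad0).
move=> N M n u0 U S dt tn V _ nM _ solU _ [solS SV] supU dt1; cbv zeta.
have M0 : 0 < M%:R :> R by rewrite ltr0n (leq_ltn_trans _ nM).
have dt0 : 0 < dt by rewrite divr_gt0.
have tnS : tn n.+1 = tn n + dt by rewrite /tn -natr1 mulrDl mul1r.
have tn0 : 0 <= tn n by rewrite mulr_ge0// ltW.
have tnT : tn n.+1 <= T.
  rewrite /tn /dt mulrCA ler_piMr ?(ltW T0)// ler_pdivrMr// mul1r ler_nat.
  exact: nM.
have le_tn : tn n <= tn n.+1 by rewrite tnS lerDl ltW.
clearbody tn dt.
have solV : is_solution N (transformed alpha N) (tn n) (tn n.+1) V.
  exact: flow_of_galerkin tn0 tnT solU.
have SE : S (tn n.+1) = V (tn n.+1).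
  exact: (flow_unique alpha0 le_tn solS solV SV).
have UE : (fun t => expL alpha t (V t)) = U.
  by apply/funext => t; rewrite /V expLKN.
rewrite SE; rewrite tnS in solV supU *.
clearbody V.
by apply: (local_error halpha hq Rad0 dt0 dt1); [split|rewrite UE].
Qed.
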